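(* Let $k\ge 2$ and let $G\subseteq H$ be $k$-graphs with $e_G\ge1$. Assume that there is exactly one copy of $G$ in $H$, and that $p=p(n)\in[0,1]$ satisfies $p=o(1)$ and is such that $\mathbb E X_G=o(\mathbb E X_J)$ for all $J\subseteq H$ with $J\ne G$ and $e_J\ge1$. Suppose that $\varepsilon=\varepsilon(n)\in(0,1]$ is such that there is a function $\omega=\omega(n)\to\infty$ with $$\varepsilon^2\,\mathbb E X_G\ \ge\ \mathbf 1_{\{\varepsilon<1\}}\;\omega\cdot\bigl(1+\mathbf 1_{\{G\neq H,\ e_G\ge2\}}\log(1/\varepsilon)\bigr).$$ Then, as $n\to\infty$, $$\log\mathbb P(X_H\le(1-\varepsilon)\mathbb E X_H)\ \sim\ -\varphi(-\varepsilon)\,\mathbb E X_G .$$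
   Context: A $k$-graph is a (finite) $k$-uniform hypergraph; isolated vertices are allowed. $e_H=|E(H)|$ and $v_H=|V(H)|$. $J\subseteq H$ means that $J$ is a (not necessarily induced) subgraph of $H$. $G^{(k)}_{n,p}$ is the random $k$-graph on $[n]=\{1,\dots,n\}$ in which each of the $\binom nk$ edges of the complete $k$-graph $K_n^{(k)}$ is included independently with probability $p$. For a $k$-graph $J$, $X_J=X_J(n,p)$ is the number of copies of $J$ in $G^{(k)}_{n,p}$, where a copy of $J$ is a subgraph isomorphic to $J$. The function $\varphi$ is $\varphi(x)=(1+x)\log(1+x)-x$ for $x\ge-1$, with $\varphi(-1)=1$. $G,H,k$ are fixed and all asymptotics are as $n\to\infty$; $a_n\sim b_n$ means $a_n=(1+o(1))b_n$. $\mathbf 1_{\{A\}}$ equals $1$ if $A$ holds and $0$ otherwise. *)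

(* Defs.v *)
From HB Require Import structures.
From mathcomp Require Export all_boot all_order all_algebra.
From mathcomp Require Export all_classical all_reals all_analysis.
Export Order.TTheory GRing.Theory Num.Theory.
Export numFieldNormedType.Exports.

Set Implicit Arguments.
Unset Strict Implicit.
Unset Printing Implicit Defensive.

#[global] Open Scope classical_set_scope.
#[global] Open Scope ring_scope.

(* A k-graph carries its own vertex set inside an ambient finite type T, so
   that subgraphs of H are again k-graphs over T, are compared by Leibniz
   equality, and may have isolated vertices. *)
Definition is_kgraph (k : nat) (T : finType)
    (x : {set T} * {set {set T}}) : bool :=
  [forall e in x.2, (e \subset x.1) && (#|e| == k)].

Record kgraph (k : nat) (T : finType) := KGraph {
  kgraph_val :> {set T} * {set {set T}};
  kgraph_valP : is_kgraph k kgraph_val }.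

HB.instance Definition _ (k : nat) (T : finType) :=
  [isSub for @kgraph_val k T].
HB.instance Definition _ (k : nat) (T : finType) :=
  [Finite of kgraph k T by <:].

Definition vset (k : nat) (T : finType) (J : kgraph k T) : {set T} :=
  (kgraph_val J).1.

Definition eset (k : nat) (T : finType) (J : kgraph k T) : {set {set T}} :=
  (kgraph_val J).2.

Definition subgraph (k : nat) (T : finType) (J K : kgraph k T) : bool :=
  (vset J \subset vset K) && (eset J \subset eset K).

(* f is total on T, but only its restriction to the vertices of J matters. *)
Definition isomorphic (k : nat) (T U : finType)
    (J : kgraph k T) (F : kgraph k U) : bool :=
  [exists f : {ffun T -> U},
    [&& dinjectiveb f (vset J),
        f @: vset J == vset F &
        [set f @: e | e : {set T} in eset J] == eset F]].

Definition ncopies (k : nat) (T U : finType)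
    (J : kgraph k T) (K : kgraph k U) : nat :=
  #|[set F : kgraph k U | subgraph F K && isomorphic J F]%SET|.

(* The law of the random k-graph on n vertices: outcomes have vertex set all of
   'I_n, and the k-subsets of 'I_n are independently edges with probability
   p. *)
Definition gnp_mass (R : realType) (k n : nat) (p : R)
    (K : kgraph k 'I_n) : R :=
  (vset K == [set: 'I_n]%SET)%:R *
  \prod_(e : {set 'I_n} | #|e| == k) (if e \in eset K then p else 1 - p).

Definition gnp_prob (R : realType) (k n : nat) (p : R)
    (A : pred (kgraph k 'I_n)) : R :=
  \sum_(K : kgraph k 'I_n | A K) gnp_mass p K.

Definition gnp_expect (R : realType) (k n : nat) (p : R)
    (X : kgraph k 'I_n -> R) : R :=
  \sum_(K : kgraph k 'I_n) gnp_mass p K * X K.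

Definition copies (R : realType) (k : nat) (T : finType) (J : kgraph k T)
    (n : nat) (K : kgraph k 'I_n) : R :=
  (ncopies J K)%:R.

Definition mean_copies (R : realType) (k : nat) (T : finType)
    (J : kgraph k T) (n : nat) (p : R) : R :=
  gnp_expect p (copies R J (n := n)).

(* Since ln 0 = 0 in the library, phi (-1) = 1 as in the usual convention. *)
Definition phi (R : realType) (x : R) : R := (1 + x) * ln (1 + x) - x.

(* Main.v *)
Require Import Defs.
From mathcomp Require Import fingroup perm ring lra.

Set Implicit Arguments.
Unset Strict Implicit.
Unset Printing Implicit Defensive.

(** Janson's inequality for X_H gives the upper bound: copies of H sharing a
    graph J contribute EX_H / EX_J per copy, and only J = G matters, so the
    dependency term is (1 + o(1)) EX_H / EX_G.  Conversely, Harris' inequality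
    bounds the Laplace transform of X_G from below, matching Janson's upper
    bound up to exp (o(s^2 EX_G)); after an exponential change of measure this
    gives P(X_G <= (1 - e')EX_G) for e' slightly larger than e.  Given this
    decreasing event D, E(X_H | D) <= (1 - e')EX_H because every copy of H lies
    over a unique copy of G, and Markov's inequality loses only a factor of
    order e; for e near 1 one uses P(X_H = 0) >= P(X_G = 0) instead. *)


(** * Product Bernoulli measures *)

(** The factor of order [eps] lost to Markov is what [ln (1 / eps)] in the hypothesis pays for: its
    logarithm must be small against [phi (- eps)] times EX_G, which is at least eps^2 EX_G / 4.
    Nothing is lost when G and H have equally many edges, since X_H is then a multiple of X_G; and a
    unique copy of a one-edge G forces H to have one edge as well, so the logarithm is needed only
    for e_G >= 2. The change of measure breaks down as [eps] tends to 1, because the tilt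
    [- ln (1 - eps)] is unbounded, and for [eps = 1] the hypothesis says nothing about the size of
    EX_G. Hence a cut at [1 - eta]: above it [phi (- eps)] differs from 1 by at most the order of
    sqrt eta, and the exponent EX_G of P(X_G = 0) is good enough. All estimates are made for fixed n
    at a given accuracy [delta]; the constants [eta], [z], [kap], [W] depend on [delta] alone, and
    limits enter only through finitely many conditions valid for large n. *)

Section BernoulliExpectation.
Context {R : realType} {E : finType}.
Implicit Types (p : R) (l : seq E) (f g : {set E} -> R) (S A : {set E}).

(* Recursion on the list of coins turns conditioning and Harris' inequality into
   plain inductions; [bexp_sumE] recovers the sum over subsets. *)
Fixpoint bexp p l f : R :=
  if l is e :: l' then
    p * bexp p l' (fun S => f (e |: S)) + (1 - p) * bexp p l' f
  else f finset.set0.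

Definition antitone f := forall S A, S \subset A -> f A <= f S.

Lemma bexp_le p l f g : 0 <= p <= 1 ->
  (forall S, {subset S <= l} -> f S <= g S) -> bexp p l f <= bexp p l g.
Proof.
move=> /andP[p0 p1]; elim: l f g => [|e l IH] f g fg /=.
  by apply: fg => x; rewrite finset.inE.
have q0 : 0 <= 1 - p by lra.
apply: lerD; apply: ler_wpM2l => //; apply: IH => S Sl; apply: fg => x.
  by rewrite !inE => /orP[->//|/Sl ->]; rewrite orbT.
by move=> /Sl xl; rewrite inE xl orbT.
Qed.

Lemma eq_bexp p l f g :
  (forall S, {subset S <= l} -> f S = g S) -> bexp p l f = bexp p l g.
Proof.
elim: l f g => [|e l IH] f g fg /=.
  by apply: fg => x; rewrite finset.inE.
congr (_ * _ + _ * _); apply: IH => S Sl; apply: fg => x.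
  by rewrite !inE => /orP[->//|/Sl ->]; rewrite orbT.
by move=> /Sl xl; rewrite inE xl orbT.
Qed.

Arguments eq_bexp {p l f g}.

Lemma bexp_cst p l c : bexp p l (fun=> c) = c.
Proof. by elim: l => //= e l ->; ring. Qed.

Lemma bexpD p l f g :
  bexp p l (fun S => f S + g S) = bexp p l f + bexp p l g.
Proof. by elim: l f g => //= e l IH f g; rewrite !IH; ring. Qed.

Lemma bexpZ p l c f : bexp p l (fun S => c * f S) = c * bexp p l f.
Proof. by elim: l f => //= e l IH f; rewrite !IH; ring. Qed.

Lemma bexp_sum p l (I : Type) (r : seq I) (P : pred I)
    (F : I -> {set E} -> R) :
  bexp p l (fun S => \sum_(i <- r | P i) F i S) =
  \sum_(i <- r | P i) bexp p l (F i).
Proof.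
elim: l F => //= e l IH F.
by rewrite !IH !mulr_sumr -big_split.
Qed.

Lemma bexp_ge0 p l f : 0 <= p <= 1 -> (forall S, 0 <= f S) -> 0 <= bexp p l f.
Proof.
by move=> hp f0; rewrite -(bexp_cst p l 0); apply: bexp_le => // S _.
Qed.

(** Splitting on one coin, the induction hypothesis leaves the gap
    [p * (1 - p) * ((f0 - f1) * (g0 - g1))], a product of nonnegative differences because both
    functions decrease when the coin comes up. *)
Lemma harris p l f g : 0 <= p <= 1 -> antitone f -> antitone g ->
  bexp p l f * bexp p l g <= bexp p l (fun S => f S * g S).
Proof.
move=> hp; have /andP[p0 p1] := hp.
elim: l f g => [|e l IH] f g fA gA //=.
have fe : antitone (fun S => f (e |: S)) by move=> S A SA; apply/fA/finset.setUS.
have ge : antitone (fun S => g (e |: S)) by move=> S A SA; apply/gA/finset.setUS.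
have f10 : bexp p l (fun S => f (e |: S)) <= bexp p l f.
  by apply: bexp_le => // S _; apply/fA/finset.subsetUr.
have g10 : bexp p l (fun S => g (e |: S)) <= bexp p l g.
  by apply: bexp_le => // S _; apply/gA/finset.subsetUr.
have q0 : 0 <= 1 - p by lra.
apply: (le_trans _ (lerD (ler_wpM2l p0 (IH _ _ fe ge)) (ler_wpM2l q0 (IH _ _ fA gA)))).
move: f10 g10; set f1 := bexp _ _ _; set f0 := bexp _ _ f.
set g1 := bexp _ _ _; set g0 := bexp _ _ g => f10 g10.
have : 0 <= p * (1 - p) * ((f0 - f1) * (g0 - g1)).
  by rewrite !mulr_ge0 // subr_ge0.
by move=> h; rewrite -subr_ge0; apply: le_trans h _; rewrite le_eqVlt; apply/orP; left;
  apply/eqP; ring.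
Qed.

Lemma antitone_prod (I : Type) (r : seq I) (P : pred I) (F : I -> {set E} -> R) :
  (forall i S, 0 <= F i S) -> (forall i, antitone (F i)) ->
  antitone (fun S => \prod_(i <- r | P i) F i S).
Proof. by move=> F0 FA S A SA; apply: ler_prod => i _; rewrite F0 FA. Qed.

Lemma harris_prod p l (I : Type) (r : seq I) (P : pred I) (F : I -> {set E} -> R) :
  0 <= p <= 1 -> (forall i S, 0 <= F i S) -> (forall i, antitone (F i)) ->
  \prod_(i <- r | P i) bexp p l (F i) <=
  bexp p l (fun S => \prod_(i <- r | P i) F i S).
Proof.
move=> hp F0 FA; elim: r => [|i r IH].
  by rewrite big_nil (eq_bexp (g := fun=> 1)) ?bexp_cst // => S _; rewrite big_nil.
rewrite big_cons; have [Pi|nPi] := boolP (P i); last first.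
  by apply: le_trans IH _; apply: bexp_le => // S _; rewrite big_cons (negbTE nPi).
rewrite [leRHS](eq_bexp (g := fun S => F i S * \prod_(j <- r | P j) F j S)); last first.
  by move=> S _; rewrite big_cons Pi.
apply: le_trans (harris _ hp (FA i) (antitone_prod _ _ F0 FA)).
by apply: ler_wpM2l => //; apply: bexp_ge0.
Qed.

(** Average of the tangent-line bound for [expR] at the mean [m]. *)
Lemma jensen_expR p l f : 0 <= p <= 1 ->
  expR (bexp p l f) <= bexp p l (fun S => expR (f S)).
Proof.
move=> hp; set m := bexp p l f.
have -> : expR m = bexp p l (fun S => expR m * (1 + (f S - m))).
  rewrite bexpZ (bexpD p l (fun=> 1)) bexp_cst (bexpD p l f (fun=> - m)) bexp_cst.
  by rewrite subrr addr0 mulr1.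
apply: bexp_le => // S _.
rewrite -[in leRHS](subrKC m (f S)) expRD ler_pM2l ?expR_gt0 //.
exact: expR_ge1Dx.
Qed.

Lemma bexp_mem p l e f : uniq l -> e \in l ->
  bexp p l (fun S => (e \in S)%:R * f S) = p * bexp p l (fun S => f (e |: S)).
Proof.
elim: l f => //= x l IH f /andP[xl ul]; rewrite inE => /orP[/eqP ex|el]; first subst e.
  rewrite (eq_bexp (g := fun S => f (x |: S))); last first.
    by move=> S _; rewrite setU11 mul1r.
  rewrite [X in _ + _ * X](eq_bexp (g := fun=> 0)); last first.
    by move=> S Sl; case: (boolP (x \in S)) => [/Sl|_]; rewrite ?(negbTE xl) ?mul0r.
  rewrite bexp_cst [in RHS](eq_bexp (g := fun S => f (x |: S))); last first.
    by move=> S _; rewrite finset.setUA finset.setUid.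
  ring.
have ex : (e == x) = false by apply/negbTE; apply: contraNneq xl => <-.
rewrite (eq_bexp (g := fun S => (e \in S)%:R * f (x |: S))); last first.
  by move=> S _; rewrite !inE ex.
rewrite !IH //.
have -> : bexp p l (fun S => f (e |: (x |: S))) = bexp p l (fun S => f (x |: (e |: S))).
  by apply: eq_bexp => S _; rewrite finset.setUCA.
ring.
Qed.

(** Replaces conditioning on the presence of [A]: its coins all come up with probability
    [p ^+ #|A|], independently of the rest, and whatever [S] draws on [A] is absorbed by the
    union. *)
Lemma bexp_subset p l A f : uniq l -> {subset A <= l} ->
  bexp p l (fun S => (A \subset S)%:R * f S) =
  p ^+ #|A| * bexp p l (fun S => f (A :|: S)).
Proof.
move=> ul; move: {-1}#|A| (erefl #|A|) => n; elim: n A f => [|n IH] A f cA Al.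
  move/eqP: cA; rewrite cards_eq0 => /eqP ->.
  by rewrite expr0 mul1r; apply: eq_bexp => S _; rewrite finset.sub0set finset.set0U mul1r.
have [e eA] : exists e, e \in A by apply/set0Pn; rewrite -cards_eq0 cA.
have cAe : #|A :\ e| = n by move: cA; rewrite (cardsD1 e A) eA => -[].
have Ael : {subset A :\ e <= l} by move=> x; rewrite !inE => /andP[_ /Al].
rewrite (eq_bexp (g := fun S => (e \in S)%:R * ((A :\ e \subset S)%:R * f S))); last first.
  move=> S _; rewrite mulrA -natrM mulnb; congr (_%:R * _); congr nat_of_bool.
  by rewrite -[in LHS](finset.setD1K eA) finset.subUset finset.sub1set.
rewrite bexp_mem ?Al //.
rewrite (eq_bexp (g := fun S => (A :\ e \subset S)%:R * f (e |: S))); last first.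
  move=> S _; congr (_%:R * _); congr nat_of_bool.
  apply/fintype.subsetP/fintype.subsetP => h x xA; last by rewrite !inE h ?orbT.
  by have := h x xA; move: xA; rewrite !inE => /andP[/negbTE ->].
rewrite IH // exprS -!mulrA; congr (_ * (_ * _)); apply: eq_bexp => S _.
by rewrite finset.setUA finset.setD1K.
Qed.

Lemma bexp_sumE p l f : uniq l ->
  bexp p l f =
  \sum_(S : {set E} | S \subset [set x in l]%SET)
    (\prod_(e <- l) (if e \in S then p else 1 - p)) * f S.
Proof.
elim: l f => [|e l IH] f /=.
  move=> _; rewrite (big_pred1 finset.set0); first by rewrite big_nil mul1r.
  by move=> S /=; rewrite -finset.subset0; congr (S \subset _); apply/finset.setP => x; rewrite !inE.
move=> /andP[el ul]; rewrite !IH //.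
rewrite [RHS](bigID (fun S : {set E} => e \in S)) /=; congr (_ + _).
  rewrite mulr_sumr [RHS](reindex_onto (fun S => e |: S) (fun S => S :\ e)) /=; last first.
    by move=> S /andP[_ eS]; rewrite finset.setD1K.
  apply: eq_big => [S|S Sl].
    rewrite setU11 andbT.
    apply/idP/andP => [/fintype.subsetP Sl|[/fintype.subsetP Sl /eqP SS]].
      split; first by apply/fintype.subsetP => x; rewrite !inE => /orP[->//|/Sl]; rewrite inE orbC => ->.
      apply/eqP/finset.setU1K; apply: contra el => /Sl; by rewrite inE.
    apply/fintype.subsetP => x xS; have := Sl x; rewrite !inE xS orbT => /(_ isT) /orP[/eqP xe|//].
    by move: xS; rewrite -SS xe !inE eqxx.
  rewrite big_cons setU11 !mulrA; congr (_ * _ * _); apply: eq_big_seq => x xl.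
  by rewrite !inE; case: eqP => // xe; rewrite -xe xl in el.
rewrite mulr_sumr; apply: eq_big => [S|S Sl].
  apply/idP/andP => [/fintype.subsetP Sl|[/fintype.subsetP Sl eS]].
    split; first by apply/fintype.subsetP => x /Sl; rewrite !inE orbC => ->.
    by apply: contra el => /Sl; rewrite inE.
  apply/fintype.subsetP => x xS; have := Sl x xS; rewrite !inE => /orP[/eqP xe|//].
  by rewrite -xe xS in eS.
rewrite big_cons ifN ?mulrA //; apply: contra el => eS.
by have := fintype.subsetP Sl _ eS; rewrite inE.
Qed.

End BernoulliExpectation.
Arguments eq_bexp {R E p l f g}.


(** * Janson's inequality *)

Section CountingFamily.
Context {R : realType} {E I : finType}.
Variables (p : R) (l : seq E) (C : {set I}) (ed : I -> {set E}) (m : nat).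
Hypothesis hp : 0 <= p <= 1.
Hypothesis ul : uniq l.
Hypothesis edl : forall i, i \in C -> {subset ed i <= l}.
Hypothesis edm : forall i, i \in C -> #|ed i| = m.

(** Counts indices rather than sets, since distinct copies may have the same edge set when there are
    isolated vertices. *)
Definition cnt (S : {set E}) : R := \sum_(i in C) (ed i \subset S)%:R.

Let mu : R := #|C|%:R * p ^+ m.

Lemma is_derive_expRN (c s : R) :
  is_derive s 1 (fun x => expR (- (x * c))) (- c * expR (- (s * c))).
Proof.
have h : is_derive s 1 (fun x : R => - (x * c)) (- c).
  have h0 : is_derive s 1 (fun x : R => c * x) (c * 1).
    exact: (is_deriveZ c (is_derive_id s (1 : R))).
  have -> : (fun x : R => - (x * c)) = - (fun x : R => c * x).
    by apply/funext => x; rewrite fctE mulrC.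
  by rewrite -[in - c](mulr1 c); exact: is_deriveN.
have := @is_derive1_comp _ expR _ s _ _ (is_derive_expR _) h.
by rewrite mulrC.
Qed.

Lemma is_derive_bexp (F : R -> {set E} -> R) dF (x : R) l' :
  (forall S, is_derive x 1 (F ^~ S) (dF S)) ->
  is_derive x 1 (fun s => bexp p l' (F s)) (bexp p l' dF).
Proof.
elim: l' F dF => [|e l' IH] F dF h //=.
have h1 := IH (fun s S => F s (e |: S)) (fun S => dF (e |: S)) (fun S => h _).
have h2 := IH F dF h.
exact: (is_deriveD (is_deriveZ p h1) (is_deriveZ (1 - p) h2)).
Qed.

Lemma cnt_ge0 S : 0 <= cnt S.
Proof. by apply: sumr_ge0. Qed.

Lemma bexp_mem_subset i : i \in C ->
  bexp p l (fun S => (ed i \subset S)%:R) = p ^+ m.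
Proof.
move=> iC; have := @bexp_subset _ _ p l (ed i) (fun=> 1) ul (edl iC).
rewrite bexp_cst mulr1 edm // => <-.
by apply: eq_bexp => S _; rewrite mulr1.
Qed.

Lemma bexp_cnt : bexp p l cnt = mu.
Proof.
rewrite /cnt bexp_sum (eq_bigr (fun=> p ^+ m)) ?sumr_const /mu ?mulr_natl //.
by move=> i iC; rewrite bexp_mem_subset.
Qed.

(** The set [B] and the subfamily [P] make both factors of the split Laplace transform instances:
    one has [ed i] forced, the other has nothing forced. *)
Lemma antitone_expR (J : Type) (r : seq J) (P : pred J) (A : J -> {set E}) (B : {set E}) (s : R) :
  0 <= s ->
  antitone (fun S => expR (- (s * \sum_(j <- r | P j) (A j \subset B :|: S)%:R)) : R).
Proof.
move=> s0 S S' SS'; rewrite ler_expR lerN2; apply: ler_wpM2l => //.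
apply: ler_sum => j _; rewrite ler_nat.
have [h|//] := boolP (A j \subset B :|: S).
by rewrite (fintype.subset_trans h) // finset.setUS.
Qed.

(** Uniform form of Janson's dependency term: given that member [i] is present, [D] bounds the
    expected number of present members sharing an element with it, [i] itself included if [ed i] is
    nonempty. Thus [mu * D] bounds the usual sum over ordered dependent pairs. *)
Variable D : R.
Hypothesis D_gt0 : 0 < D.
Hypothesis hD : forall i, i \in C ->
  \sum_(j in C | ~~ [disjoint ed j & ed i]) p ^+ #|ed j :\: ed i| <= D.

Let M (s : R) := bexp p l (fun S => expR (- (s * cnt S))).

(* Split [cnt (ed i :|: S)] into the members meeting [ed i] and the others:
   the two exponentials are positively correlated, Jensen's inequality handles
   the first, and the second dominates the whole Laplace transform. *)
Lemma laplace_conditional i (s : R) : i \in C -> 0 <= s ->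
  expR (- (s * D)) * M s <= bexp p l (fun S => expR (- (s * cnt (ed i :|: S)))).
Proof.
move=> iC s0.
pose Y S : R := \sum_(j in C | ~~ [disjoint ed j & ed i]) (ed j \subset ed i :|: S)%:R.
pose Z S : R := \sum_(j in C | [disjoint ed j & ed i]) (ed j \subset finset.set0 :|: S)%:R.
have hYZ S : cnt (ed i :|: S) = Y S + Z S.
  rewrite /cnt (bigID (fun j => [disjoint ed j & ed i]%B)) /= addrC; congr (_ + _).
  apply: eq_bigr => j /andP[_ dji]; rewrite finset.set0U; congr (_%:R); congr nat_of_bool.
  apply/fintype.subsetP/fintype.subsetP => h x xj; last by rewrite !inE h ?orbT.
  by have := h x xj; rewrite !inE (disjointFr dji xj).
rewrite [leRHS](eq_bexp (g := fun S => expR (- (s * Y S)) * expR (- (s * Z S)))); last first.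
  by move=> S _; rewrite hYZ mulrDr opprD expRD.
apply: le_trans (harris _ hp (antitone_expR _ _ _ _ s0) (antitone_expR _ _ _ _ s0)).
apply: ler_pM; first exact: expR_ge0.
- by apply: bexp_ge0 => // S; exact: expR_ge0.
- have -> : - (s * D) = - s * D by ring.
  apply: le_trans (jensen_expR _ _ hp).
  rewrite ler_expR (eq_bexp (g := fun S => - s * Y S)); last by move=> S _; rewrite mulNr.
  rewrite bexpZ !mulNr lerN2; apply: ler_wpM2l => //.
  apply: le_trans (hD iC); rewrite /Y bexp_sum; apply: ler_sum => j /andP[jC _].
  have djl : {subset ed j :\: ed i <= l} by move=> x; rewrite inE => /andP[_ /(edl jC)].
  have := @bexp_subset _ _ p l (ed j :\: ed i) (fun=> 1) ul djl.
  rewrite bexp_cst mulr1 => <-.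
  by apply: bexp_le => // S _; rewrite mulr1 finset.subDset.
apply: bexp_le => // S _; rewrite ler_expR lerN2; apply: ler_wpM2l => //.
rewrite /Z /cnt [leRHS](bigID (fun j => [disjoint ed j & ed i]%B)) /=.
rewrite (eq_bigr (fun j => (ed j \subset S)%:R)); last by move=> j _; rewrite finset.set0U.
by rewrite lerDl; apply: sumr_ge0.
Qed.

(** The right side is minus the derivative of [M], so this is a differential inequality for the
    Laplace transform. It sums the conditional bound over the members, each present with probability
    [p ^+ m]. *)
Lemma laplace_deriv_le (s : R) : 0 <= s ->
  mu * expR (- (s * D)) * M s <= bexp p l (fun S => cnt S * expR (- (s * cnt S))).
Proof.
move=> s0; rewrite [leRHS](eq_bexp (g := fun S =>
    \sum_(i in C) (ed i \subset S)%:R * expR (- (s * cnt S)))); last first.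
  by move=> S _; rewrite mulr_suml.
rewrite bexp_sum /mu -!mulrA mulr_natl -sumr_const.
apply: ler_sum => i iC; rewrite (bexp_subset _ _ ul (edl iC)) edm //.
apply: ler_wpM2l; first by apply: exprn_ge0; case/andP: hp.
exact: laplace_conditional.
Qed.

Lemma is_derive_laplace (s : R) :
  is_derive s 1 M (- bexp p l (fun S => cnt S * expR (- (s * cnt S)))).
Proof.
have -> : - bexp p l (fun S => cnt S * expR (- (s * cnt S))) =
          bexp p l (fun S => - cnt S * expR (- (s * cnt S))).
  rewrite -mulN1r -bexpZ; apply: eq_bexp => S _; ring.
apply: is_derive_bexp => S.
exact: is_derive_expRN.
Qed.

(** Integrates the differential inequality: with [h] the inverse of the claimed bound, [M * h] is
    nonincreasing on [0, s] and equals 1 at 0. *)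
Lemma laplace_upper (s : R) : 0 <= s ->
  M s <= expR (- (mu * ((1 - expR (- (s * D))) / D))).
Proof.
move=> s0.
pose h (x : R) := expR (- ((expR (- (x * D)) - 1) * (mu / D))).
have dh (x : R) : is_derive x 1 h (mu * expR (- (x * D)) * h x).
  have h1 := @is_derive1_comp _ (fun y => expR (- (y * (mu / D))))
    (fun x => expR (- (x * D)) + (cst (-1) x : R)) x _ _
    (is_derive_expRN (mu / D) _) (is_deriveD (is_derive_expRN D x) (is_derive_cst _ _ _)).
  apply: is_derive_eq h1 _.
  rewrite /h /cst /= addr0; set a := expR _; set b := expR _.
  by field; rewrite gt_eqF.
pose g := M * h.
have dg (x : R) := is_deriveM (is_derive_laplace x) (dh x).
have g0 : g 0 = 1.
  rewrite /g /h fctE /M mul0r oppr0 expR0 subrr mul0r oppr0 expR0 mulr1.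
  rewrite (eq_bexp (g := fun=> 1)) ?bexp_cst // => S _.
  by rewrite mul0r oppr0 expR0.
have gle : g s <= g 0.
  apply: (@ler0_derive1_le_cc _ g 0 s); rewrite ?in_itv /= ?lexx ?s0 //.
  - move=> x; rewrite in_itv /= => /andP[x0 _].
    rewrite derive1E derive_val /=.
    have := laplace_deriv_le (ltW x0).
    have : 0 < h x by exact: expR_gt0.
    set h' := h x; set B := bexp _ _ _; set a := expR _ => h0 hB.
    rewrite /GRing.scale /=.
    have -> : M x * (mu * a * h') + h' * - B = - (h' * (B - mu * a * M x)) by ring.
    by rewrite oppr_le0 mulr_ge0 ?subr_ge0 // ltW.
  - apply: continuous_subspaceT => x.
    by apply: differentiable_continuous; apply/derivable1_diffP.
move: gle; rewrite g0 /g fctE -ler_pdivlMr ?expR_gt0 // div1r -expRN opprK.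
by congr (_ <= expR _); field; rewrite gt_eqF.
Qed.

Lemma chernoff (s a : R) : 0 <= s ->
  bexp p l (fun S => (cnt S <= a)%R%:R) <= expR (s * a) * M s.
Proof.
move=> s0; rewrite -bexpZ; apply: bexp_le => // S _; rewrite -expRD.
have [h|h] := leP (cnt S) a; last exact: expR_ge0.
rewrite -[leLHS]expR0 ler_expR -mulrBr mulr_ge0 ?subr_ge0 //.
Qed.

(** In the variable [x = s * D] the optimal Chernoff parameter has [expR (- x) = 1 - eps]. For
    [eps = 1] it lies at infinity, and the bound is reached by letting [y = expR (- x)] tend to
    0. *)
Lemma lower_tail_le (eps : R) : 0 < eps <= 1 ->
  bexp p l (fun S => (cnt S <= (1 - eps) * mu)%R%:R) <= expR (- (mu / D * phi (- eps))).
Proof.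
move=> /andP[e0 e1]; rewrite /phi opprK.
have mu0 : 0 <= mu by rewrite mulr_ge0 // exprn_ge0 //; case/andP: hp.
have key x : 0 <= x -> bexp p l (fun S => (cnt S <= (1 - eps) * mu)%R%:R) <=
    expR (- (mu / D * (1 - expR (- x) - x * (1 - eps)))).
  move=> x0; have xD : 0 <= x / D by rewrite divr_ge0 // ltW.
  apply: le_trans (chernoff _ xD) _.
  apply: le_trans (ler_wpM2l (expR_ge0 _) (laplace_upper xD)) _.
  rewrite -expRD divfK ?gt_eqF // ler_expR le_eqVlt; apply/orP; left; apply/eqP.
  by field; rewrite gt_eqF.
have [e_eq1|e_neq1] := eqVneq eps 1; last first.
  have e_lt1 : 0 < 1 - eps by rewrite subr_gt0 lt_neqAle e_neq1.
  have l0 : 0 <= - ln (1 - eps) by rewrite oppr_ge0 ln_le0 //; lra.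
  have := key _ l0; rewrite opprK lnK ?posrE // => /le_trans; apply.
  rewrite ler_expR le_eqVlt; apply/orP; left; apply/eqP; ring.
have {}key y : 0 < y <= 1 ->
    bexp p l (fun S => (cnt S <= (1 - eps) * mu)%R%:R) <= expR (mu / D * y - mu / D).
  move=> /andP[y0 y1]; have l0 : 0 <= - ln y by rewrite oppr_ge0 ln_le0.
  have := key _ l0; rewrite opprK lnK ?posrE // => /le_trans; apply.
  rewrite e_eq1 ler_expR le_eqVlt; apply/orP; left; apply/eqP; ring.
have -> : mu / D * ((1 - eps) * ln (1 - eps) + eps) = mu / D by rewrite e_eq1; ring.
set P := bexp _ _ _ in key *; rewrite leNgt; apply/negP => Pgt.
have P0 : 0 < P by apply: lt_trans Pgt; exact: expR_gt0.
have d0 : 0 < ln P + mu / D by rewrite -[mu / D]opprK subr_gt0 -[ltLHS]expRK ltr_ln ?posrE ?expR_gt0.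
have {}key y : 0 < y <= 1 -> ln P + mu / D <= mu / D * y.
  move=> /key h; rewrite -lerBrDr -[leRHS]expRK ler_ln ?posrE ?expR_gt0 //.
have a0 : 0 < mu / D by rewrite (lt_le_trans d0) // (le_trans (key 1 _)) ?mulr1 // ltr01 lexx.
(* For this [y], [mu / D * y] is at most half of the assumed excess [ln P + mu / D], whereas [key]
   makes it at least the whole excess. *)
pose y := Num.min 1 ((ln P + mu / D) / (2 * (mu / D))).
have a20 : 0 < 2 * (mu / D) by lra.
have y0 : 0 < y by rewrite lt_min ltr01 divr_gt0.
have y1 : y <= 1 by rewrite ge_min lexx.
have := key y; rewrite y0 y1 => /(_ isT) keyy.
suff : mu / D * y < ln P + mu / D by rewrite ltNge keyy.
apply: (@le_lt_trans _ _ (mu / D * ((ln P + mu / D) / (2 * (mu / D))))).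
  by rewrite ler_pM2l // ge_min lexx orbT.
set b := mu / D in a0 d0 *.
have -> : b * ((ln P + b) / (2 * b)) = (ln P + b) / 2 by field; rewrite gt_eqF.
lra.
Qed.

Lemma one_sub_ge_expR (x : R) : 0 <= x -> x <= 1 / 4 -> expR (- (x + x ^+ 2)) <= 1 - x.
Proof.
move=> x0 x1; have h : 0 < 1 - x by lra.
rewrite expRN -[leRHS]invrK lef_pV2 ?posrE ?invr_gt0 ?expR_gt0 //.
(* Using [1 + y <= expR y] at [y = x + x ^+ 2] only gives [(1 + y) * (1 - x) = 1 - x ^+ 3], short of
   1. Applied at [y / 2] and squared, it gains the missing second-order term. *)
have -> : x + x ^+ 2 = (x + x ^+ 2) / 2 + (x + x ^+ 2) / 2 by field.
rewrite expRD -expr2 -div1r ler_pdivrMr //.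
have y0 : 0 <= 1 + (x + x ^+ 2) / 2 by nra.
have : (1 + (x + x ^+ 2) / 2) ^+ 2 <= expR ((x + x ^+ 2) / 2) ^+ 2.
  by rewrite ler_sqr ?nnegrE ?expR_ge0 // expR_ge1Dx.
move=> hh; apply: le_trans (ler_wpM2r (ltW h) hh).
have : 0 <= x ^+ 2 * (1 - 3 * x - x ^+ 2 - x ^+ 3).
  apply: mulr_ge0; first exact: sqr_ge0.
  have : x ^+ 2 <= 1 / 16 by nra.
  have : x ^+ 3 <= 1 / 16 by rewrite exprS; nra.
  lra.
nra.
Qed.

(** One Harris bound for two uses: [t = 1 - expR (- s)] turns the product into the Laplace
    transform, [t = 1] into the indicator that no member is present. Each factor has mean
    [1 - t * p ^+ m], which [p ^+ m <= 1 / 4] allows to be compared with an exponential at the cost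
    of a second-order term. *)
Lemma prod_lower (t : R) : 0 <= t <= 1 -> p ^+ m <= 1 / 4 ->
  expR (- (mu * (t + t ^+ 2 * p ^+ m))) <=
  bexp p l (fun S => \prod_(i in C) (1 - t * (ed i \subset S)%:R)).
Proof.
move=> /andP[t0 t1] q4.
have q0 : 0 <= p ^+ m by rewrite exprn_ge0 //; case/andP: hp.
apply: le_trans (harris_prod _ _ _ hp _ _) => [|i S|i S A SA]; last 2 first.
- by case: (_ \subset _); rewrite ?mulr1 ?mulr0 ?subr_ge0 ?subr0.
- rewrite lerD2l lerN2; apply: ler_wpM2l => //; rewrite ler_nat.
  by have [h|//] := boolP (ed i \subset S); rewrite (fintype.subset_trans h).
rewrite (eq_bigr (fun=> 1 - t * p ^+ m)) => [|i iC]; last first.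
  have := bexpD p l (fun=> 1) (fun S => - t * (ed i \subset S)%:R).
  rewrite bexp_cst bexpZ bexp_mem_subset // mulNr => <-.
  by apply: eq_bexp => S _; rewrite mulNr.
rewrite prodr_const /mu.
have -> : - (#|C|%:R * p ^+ m * (t + t ^+ 2 * p ^+ m)) =
          - (t * p ^+ m + (t * p ^+ m) ^+ 2) * #|C|%:R by ring.
rewrite expRM_natr lerXn2r ?nnegrE ?expR_ge0 //; first by nra.
by apply: one_sub_ge_expR; nra.
Qed.

Lemma laplace_lower (s : R) : 0 <= s -> p ^+ m <= 1 / 4 ->
  expR (- (mu * (1 - expR (- s) + s ^+ 2 * p ^+ m))) <= M s.
Proof.
move=> s0 q4.
have q0 : 0 <= p ^+ m by rewrite exprn_ge0 //; case/andP: hp.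
have mu0 : 0 <= mu by rewrite mulr_ge0.
have es1 : 0 <= 1 - expR (- s) <= 1.
  by rewrite subr_ge0 expR_le1 oppr_le0 s0 /= gerBl expR_ge0.
have := prod_lower es1 q4.
have <- : M s = bexp p l (fun S => \prod_(i in C) (1 - (1 - expR (- s)) * (ed i \subset S)%:R)).
  apply: eq_bexp => S _; rewrite /cnt -mulNr mulr_sumr expR_sum.
  apply: eq_bigr => i _; case: (_ \subset _); rewrite ?mulr1 ?mulr0 ?expR0; ring.
move=> h; apply: le_trans h.
rewrite ler_expR lerN2; apply: ler_wpM2l => //; rewrite lerD2l; apply: ler_wpM2r => //.
case/andP: es1 => es0 _; rewrite ler_sqr ?nnegrE //.
by have := expR_ge1Dx (- s); lra.
Qed.

Lemma zero_lower : p ^+ m <= 1 / 4 ->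
  expR (- (mu * (1 + p ^+ m))) <= bexp p l (fun S => (cnt S == 0)%:R).
Proof.
move=> q4; have t1 : 0 <= (1 : R) <= 1 by rewrite ler01 lexx.
have := prod_lower t1 q4; rewrite expr1n mul1r => h; apply: le_trans h _.
apply: bexp_le => // S _.
have [[i iC iS]|h] := pselect (exists2 i, i \in C & ed i \subset S).
  by rewrite (bigD1 i) //= iS mulr1 subrr mul0r.
have hS i : i \in C -> (ed i \subset S) = false.
  by move=> iC; apply/negP => iS; apply: h; exists i.
rewrite /cnt !big1 ?eqxx // => i /hS -> //.
by rewrite mulr0 subr0.
Qed.

End CountingFamily.


(** * Copies and their symmetries *)

Section KGraphMaps.
Variable k : nat.

Lemma kgraphP (T : finType) (J : kgraph k T) e :
  e \in eset J -> (e \subset vset J) /\ #|e| = k.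
Proof.
move=> eJ; have /forallP/(_ e)/implyP/(_ eJ)/andP[-> /eqP ->] := kgraph_valP J.
by [].
Qed.

Lemma kgraph_eq (T : finType) (J K : kgraph k T) :
  vset J = vset K -> eset J = eset K -> J = K.
Proof.
move=> hv he; apply: val_inj => /=.
by rewrite [kgraph_val J]surjective_pairing [kgraph_val K]surjective_pairing; congr pair.
Qed.

Lemma is_kgraph0 (T : finType) : is_kgraph k (finset.set0 : {set T}, finset.set0).
Proof. by apply/forallP => e; rewrite inE. Qed.

Definition kgraph0 (T : finType) : kgraph k T := KGraph (is_kgraph0 T).

Lemma mem_imset_on (T U : finType) (f : T -> U) (V e : {set T}) x :
  {in V &, injective f} -> e \subset V -> x \in V -> (f x \in f @: e) = (x \in e).
Proof.
move=> fi /fintype.subsetP eV xV; apply/imsetP/idP => [[y ye /fi]|xe]; last by exists x.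
by move=> -> //; exact: eV.
Qed.

Lemma imset_inj_on (T U : finType) (f : T -> U) (V e e' : {set T}) :
  {in V &, injective f} -> e \subset V -> e' \subset V -> f @: e = f @: e' -> e = e'.
Proof.
move=> fi eV e'V h; apply/finset.setP => x.
have [xV|xV] := boolP (x \in V).
  by rewrite -(mem_imset_on fi eV xV) h (mem_imset_on fi).
by apply/idP/idP => h'; case/negP: xV; [exact: (fintype.subsetP eV) | exact: (fintype.subsetP e'V)].
Qed.

(** Total in [f]: if the image is not a k-graph, as may happen when [f] is not injective on the
    vertices of [J], the value is the empty [kgraph0]. *)
Definition gmap (T U : finType) (f : T -> U) (J : kgraph k T) : kgraph k U :=
  insubd (kgraph0 U) (f @: vset J, [set f @: (e : {set T}) | e in eset J]%SET).

Lemma val_gmap (T U : finType) (f : T -> U) (J : kgraph k T) :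
  {in vset J &, injective f} ->
  kgraph_val (gmap f J) = (f @: vset J, [set f @: (e : {set T}) | e in eset J]%SET).
Proof.
move=> fi; apply: (@insubdK _ _ (kgraph k U)).
apply/forallP => e'; apply/implyP => /imsetP[e eJ ->] /=.
have [eV ek] := kgraphP eJ; rewrite imsetS //= card_in_imset ?ek //.
by apply: sub_in2 fi => x; exact/fintype.subsetP.
Qed.

Lemma vset_gmap (T U : finType) (f : T -> U) (J : kgraph k T) :
  {in vset J &, injective f} -> vset (gmap f J) = f @: vset J.
Proof. by move=> fi; rewrite /vset val_gmap. Qed.

Lemma eset_gmap (T U : finType) (f : T -> U) (J : kgraph k T) :
  {in vset J &, injective f} ->
  eset (gmap f J) = [set f @: (e : {set T}) | e in eset J]%SET.
Proof. by move=> fi; rewrite /eset val_gmap. Qed.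

Lemma isomorphicP (T U : finType) (J : kgraph k T) (F : kgraph k U) :
  reflect (exists2 f : T -> U, {in vset J &, injective f} & F = gmap f J)
          (isomorphic J F).
Proof.
apply: (iffP existsP) => [[f /and3P[/dinjectiveP fi /eqP fV /eqP fE]]|[f fi ->]].
  by exists f => //; apply: kgraph_eq; rewrite ?vset_gmap ?eset_gmap.
exists [ffun x => f x].
have im (A : {set T}) : [ffun x => f x] @: A = f @: A by apply: eq_imset => x; rewrite ffunE.
apply/and3P; split.
- by apply/dinjectiveP => x y xV yV; rewrite !ffunE; exact: fi.
- by rewrite im vset_gmap.
- by rewrite eset_gmap //; apply/eqP; apply: eq_imset => e; rewrite im.
Qed.

Lemma isomorphic_refl (T : finType) (J : kgraph k T) : isomorphic J J.
Proof.
apply/isomorphicP; exists id => //; apply: kgraph_eq.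
  by rewrite vset_gmap // imset_id.
rewrite eset_gmap // -[LHS]imset_id; apply: eq_imset => e; by rewrite imset_id.
Qed.

Lemma card_eset_gmap (T U : finType) (f : T -> U) (J : kgraph k T) :
  {in vset J &, injective f} -> #|eset (gmap f J)| = #|eset J|.
Proof.
move=> fi; rewrite eset_gmap // card_in_imset // => e e' eJ e'J.
by apply: (imset_inj_on fi); [case: (kgraphP eJ) | case: (kgraphP e'J)].
Qed.

Lemma isomorphic_card (T U : finType) (J : kgraph k T) (F : kgraph k U) :
  isomorphic J F -> #|eset F| = #|eset J|.
Proof. by move=> /isomorphicP[f fi ->]; exact: card_eset_gmap. Qed.

Lemma gmap_ext (T U : finType) (f g : T -> U) (J : kgraph k T) :
  {in vset J &, injective f} -> {in vset J, f =1 g} -> gmap f J = gmap g J.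
Proof.
move=> fi fg.
have gi : {in vset J &, injective g} by move=> x y xV yV; rewrite -!fg //; exact: fi.
apply: kgraph_eq; rewrite ?vset_gmap ?eset_gmap //.
  by apply: eq_in_imset => x xV; rewrite fg.
apply: eq_in_imset => e eJ; apply: eq_in_imset => x xe; apply: fg.
by have [/fintype.subsetP eV _] := kgraphP eJ; exact: eV.
Qed.

Lemma gmap_comp (T U W : finType) (f : T -> U) (g : U -> W) (J : kgraph k T) :
  {in vset J &, injective f} -> {in f @: vset J &, injective g} ->
  gmap g (gmap f J) = gmap (g \o f) J /\ {in vset J &, injective (g \o f)}.
Proof.
move=> fi gi; have gfi : {in vset J &, injective (g \o f)}.
  by move=> x y xV yV /gi h; apply: fi => //; apply: h; exact: imset_f.
split=> //; have gi' : {in vset (gmap f J) &, injective g} by rewrite vset_gmap.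
apply: kgraph_eq; first by rewrite !vset_gmap // imset_comp.
by rewrite !eset_gmap // -imset_comp; apply: eq_imset => e /=; rewrite imset_comp.
Qed.

Lemma isomorphic_gmap (T U W : finType) (J : kgraph k T) (F : kgraph k U) (g : U -> W) :
  {in vset F &, injective g} -> isomorphic J F -> isomorphic J (gmap g F).
Proof.
move=> gi /isomorphicP[f fi eF]; have fV : vset F = f @: vset J by rewrite eF vset_gmap.
rewrite fV in gi; have [h hi] := gmap_comp fi gi.
by apply/isomorphicP; exists (g \o f) => //; rewrite eF h.
Qed.

Lemma isomorphic_gmapV (T W : finType) (J F : kgraph k T) (g : T -> W) :
  {in vset F &, injective g} -> isomorphic J (gmap g F) -> isomorphic J F.
Proof.
move=> gi /isomorphicP[f fi eF].
have fV : g @: vset F = f @: vset J by rewrite -!vset_gmap // eF.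
have fE : [set g @: (e : {set T}) | e in eset F]%SET = [set f @: (e : {set T}) | e in eset J]%SET.
  by rewrite -!eset_gmap // eF.
(* This is the inverse of [g] on the vertices of [F], composed with [f]; the default [x] is reached
   only outside the vertices of [J]. *)
pose h x := odflt x [pick y in vset F | g y == f x].
have hP x : x \in vset J -> h x \in vset F /\ g (h x) = f x.
  move=> xV; rewrite /h; case: pickP => [y /andP[yF /eqP //]|no].
  have : f x \in g @: vset F by rewrite fV imset_f.
  by move=> /imsetP[y yF fx]; have := no y; rewrite /= yF fx eqxx.
have him (A : {set T}) : A \subset vset J -> g @: (h @: A) = f @: A.
  move=> /fintype.subsetP AJ; rewrite -imset_comp; apply: eq_in_imset => x /AJ /hP[_ /=]; by [].
have hsub (A : {set T}) : A \subset vset J -> h @: A \subset vset F.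
  move=> /fintype.subsetP AJ; apply/fintype.subsetP => _ /imsetP[x /AJ /hP[hx _] ->]; exact: hx.
have hi : {in vset J &, injective h}.
  move=> x y xV yV hxy; apply: fi => //.
  by have [_ <-] := hP x xV; have [_ <-] := hP y yV; rewrite hxy.
apply/isomorphicP; exists h => //; apply: kgraph_eq.
  rewrite vset_gmap //; apply: (imset_inj_on gi) => //; first exact: hsub.
  by rewrite him.
rewrite eset_gmap //; apply/finset.setP => e; apply/idP/imsetP => [eF'|[e' e'J ->]].
  have : g @: e \in [set f @: (e : {set T}) | e in eset J]%SET by rewrite -fE imset_f.
  move=> /imsetP[e' e'J ge]; exists e' => //; have [e'V _] := kgraphP e'J.
  apply: (imset_inj_on gi); [by case: (kgraphP eF')|exact: hsub|by rewrite him].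
have [e'V _] := kgraphP e'J.
have : f @: e' \in [set g @: (e : {set T}) | e in eset F]%SET by rewrite fE imset_f.
move=> /imsetP[e2 e2F]; rewrite -him // => h2.
have -> // : h @: e' = e2.
by apply: (imset_inj_on gi); [exact: hsub|case: (kgraphP e2F)|].
Qed.

Lemma subgraph_inj_on (T U : finType) (f : T -> U) (J H : kgraph k T) :
  {in vset H &, injective f} -> subgraph J H -> {in vset J &, injective f}.
Proof. by move=> fi /andP[/fintype.subsetP JH _]; apply: sub_in2 fi. Qed.

Lemma subgraph_gmap (T U : finType) (f : T -> U) (J H : kgraph k T) :
  {in vset H &, injective f} -> subgraph J H -> subgraph (gmap f J) (gmap f H).
Proof.
move=> fi JH; have fiJ := subgraph_inj_on fi JH; case/andP: JH => hv he.
by apply/andP; rewrite !vset_gmap // !eset_gmap //; split; apply: imsetS.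
Qed.

Lemma gmap_inj (T U : finType) (f : T -> U) (J J' H : kgraph k T) :
  {in vset H &, injective f} -> subgraph J H -> subgraph J' H ->
  gmap f J = gmap f J' -> J = J'.
Proof.
move=> fi JH J'H h.
have fiJ := subgraph_inj_on fi JH; have fiJ' := subgraph_inj_on fi J'H.
case/andP: JH => hv he; case/andP: J'H => hv' he'.
have hV := congr1 (@vset k U) h; have hE := congr1 (@eset k U) h.
rewrite !vset_gmap // in hV; rewrite !eset_gmap // in hE.
apply: kgraph_eq; first exact: (imset_inj_on fi).
apply: (@imset_inj_on _ _ (fun e : {set T} => f @: e) (eset H)) hE => //.
move=> e e' /kgraphP[eV _] /kgraphP[e'V _]; exact: (imset_inj_on fi).
Qed.

(** Vertices and edges are pulled back separately, so isolated vertices survive. It lets the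
    intersection of two copies of H be named by a subgraph of H itself. *)
Lemma gmap_surj (T U : finType) (f : T -> U) (H : kgraph k T) (F : kgraph k U) :
  {in vset H &, injective f} -> subgraph F (gmap f H) ->
  exists2 J, subgraph J H & F = gmap f J.
Proof.
move=> fi /andP[]; rewrite vset_gmap // eset_gmap // => /fintype.subsetP hv /fintype.subsetP he.
pose V := [set x in vset H | f x \in vset F]%SET.
pose E := [set e : {set T} in eset H | f @: e \in eset F]%SET.
have VH : V \subset vset H by apply/fintype.subsetP => x; rewrite inE => /andP[].
have EH : E \subset eset H by apply/fintype.subsetP => x; rewrite inE => /andP[].
have kgE : is_kgraph k (V, E).
  apply/forallP => e; apply/implyP => /=; rewrite inE => /andP[eH eF].
  have [/fintype.subsetP eV ->] := kgraphP eH; rewrite eqxx andbT.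
  apply/fintype.subsetP => x xe; rewrite inE eV //=.
  have [/fintype.subsetP h _] := kgraphP eF; apply: h; exact: imset_f.
pose J := KGraph kgE.
have JH : subgraph J H by apply/andP.
have fiJ := subgraph_inj_on fi JH.
exists J => //; apply: kgraph_eq.
  rewrite vset_gmap //; apply/finset.setP => y; apply/idP/imsetP => [yF|[x]].
    have /imsetP[x xH yx] := hv y yF; exists x => //.
    by rewrite inE xH -yx.
  by rewrite inE => /andP[_ h] ->.
rewrite eset_gmap //; apply/finset.setP => y; apply/idP/imsetP => [yF|[x]].
  have /imsetP[x xH yx] := he y yF; exists x => //.
  by rewrite inE xH -yx.
by rewrite inE => /andP[_ h] ->.
Qed.

Lemma ncopies_gmap (T U : finType) (J H : kgraph k T) (f : T -> U) :
  {in vset H &, injective f} -> ncopies J (gmap f H) = ncopies J H.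
Proof.
move=> fi; rewrite /ncopies.
have -> : [set F : kgraph k U | subgraph F (gmap f H) && isomorphic J F]%SET =
  gmap f @: [set F : kgraph k T | subgraph F H && isomorphic J F]%SET.
  apply/finset.setP => F; rewrite inE; apply/andP/imsetP => [[FH JF]|[F']].
    have [F' F'H eF] := gmap_surj fi FH; exists F' => //.
    rewrite inE F'H /=; apply: (isomorphic_gmapV (g := f)); last by rewrite -eF.
    exact: subgraph_inj_on fi F'H.
  rewrite inE => /andP[F'H JF'] ->; split; first exact: subgraph_gmap.
  by apply: isomorphic_gmap => //; exact: subgraph_inj_on fi F'H.
by apply: card_in_imset => J1 J2; rewrite !inE => /andP[h1 _] /andP[h2 _]; exact: gmap_inj fi _ _.
Qed.

(** Points of [r] are added one at a time: the transposition of [s (f x)] and [g x] corrects the new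
    point and, by injectivity, leaves the earlier values alone. The index type may be infinite, as
    it serves both for vertices and for positions in a list. *)
Lemma perm_extend (A : eqType) (U : finType) (f g : A -> U) (r : seq A) :
  {in r &, injective f} -> {in r &, injective g} ->
  exists s : {perm U}, {in r, forall x, s (f x) = g x}.
Proof.
elim: r => [|x r IH] fi gi; first by exists 1%g.
have [||s hs] := IH.
- by apply: sub_in2 fi => y yr; rewrite inE yr orbT.
- by apply: sub_in2 gi => y yr; rewrite inE yr orbT.
have [xr|xr] := boolP (x \in r).
  by exists s => y; rewrite inE => /orP[/eqP ->|]; exact: hs.
exists (s * tperm (s (f x)) (g x))%g => y; rewrite inE permM => /orP[/eqP ->|yr].
  by rewrite tpermL.
have xy : x != y by apply: contraNneq xr => ->.
have xin : x \in x :: r by rewrite inE eqxx.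
have yin : y \in x :: r by rewrite inE yr orbT.
rewrite (hs y yr) tpermD //.
  by apply: contra xy => /eqP h; apply/eqP/fi => //; apply: (@perm_inj _ s); rewrite h hs.
by apply: contra xy => /eqP h; apply/eqP/gi.
Qed.

(** The copies of [J] in the complete k-graph on [U]. *)
Definition kcopies (T U : finType) (J : kgraph k T) : {set kgraph k U} :=
  [set F : kgraph k U | isomorphic J F]%SET.

Definition supercopies (T U : finType) (H : kgraph k T) (F : kgraph k U) : {set kgraph k U} :=
  [set K in kcopies U H | subgraph F K]%SET.

(** A permutation of [U] carrying [F] to [F'] maps the copies of [H] over [F] injectively to those
    over [F']; exchanging the two gives equality. *)
Lemma card_supercopies_le (T U : finType) (J H : kgraph k T) (F F' : kgraph k U) :
  F \in kcopies U J -> F' \in kcopies U J ->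
  (#|supercopies H F| <= #|supercopies H F'|)%N.
Proof.
rewrite !inE => /isomorphicP[f fi ->] /isomorphicP[g gi ->].
have [||s hs] := @perm_extend _ _ f g (enum (vset J)).
- by move=> x y; rewrite !mem_enum; exact: fi.
- by move=> x y; rewrite !mem_enum; exact: gi.
have si (V : {set U}) : {in V &, injective s} by move=> x y _ _; exact: perm_inj.
have -> : gmap g J = gmap s (gmap f J).
  have [-> sfi] := gmap_comp fi (si _).
  by apply: gmap_ext => // x xV; rewrite /= hs ?mem_enum.
have <- : #|gmap s @: supercopies H (gmap f J)| = #|supercopies H (gmap f J)|.
  apply: card_imset => K K' h.
  have hV := congr1 (@vset k U) h; have hE := congr1 (@eset k U) h.
  rewrite !vset_gmap // in hV; rewrite !eset_gmap // in hE.
  have iset : injective (fun A : {set U} => s @: A) by apply: imset_inj; exact: perm_inj.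
  by apply: kgraph_eq; [exact: iset | exact: (imset_inj iset)].
apply: subset_leq_card; apply/fintype.subsetP => K' /imsetP[K KS ->].
move: KS; rewrite !inE => /andP[HK fK]; rewrite isomorphic_gmap //=.
exact: subgraph_gmap.
Qed.

(** Double counting of the pairs formed by a copy of [J] inside a copy of [H]; by symmetry every
    copy of [J] lies in equally many copies of [H]. *)
Lemma card_supercopies (T U : finType) (J H : kgraph k T) (F : kgraph k U) :
  F \in kcopies U J ->
  (#|supercopies H F| * #|kcopies U J| = #|kcopies U H| * ncopies J H)%N.
Proof.
move=> FJ.
have h1 : (\sum_(F' in kcopies U J) #|supercopies H F'| = #|supercopies H F| * #|kcopies U J|)%N.
  rewrite mulnC -sum_nat_const; apply: eq_bigr => F' F'J.
  by apply/eqP; rewrite eqn_leq !(@card_supercopies_le _ _ J).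
rewrite -h1.
rewrite (eq_bigr (fun F' => \sum_(K in kcopies U H) (subgraph F' K : nat))%N); last first.
  move=> F' _; rewrite -sum1_card big_mkcond [RHS]big_mkcond; apply: eq_bigr => K _.
  by rewrite !inE; case: (isomorphic _ _) => //=; case: (subgraph _ _).
rewrite exchange_big /= -sum_nat_const; apply: eq_bigr => K.
rewrite inE => /isomorphicP[f fi eK].
rewrite -(ncopies_gmap J fi) -eK /ncopies -sum1_card big_mkcond [RHS]big_mkcond.
apply: eq_bigr => F' _; rewrite !inE.
by case: (isomorphic _ _) => //=; case: (subgraph _ _).
Qed.

End KGraphMaps.


(** * Copies in the random k-graph *)

Section UniqueCopy.
Variables (k : nat) (T : finType) (G H : kgraph k T).
Hypotheses (hGH : subgraph G H) (hcopy : ncopies G H = 1%N).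

Lemma unique_copy F : subgraph F H -> isomorphic G F -> F = G.
Proof.
move=> FH GF; move/eqP: hcopy => /cards1P[K hK].
have : G \in [set F : kgraph k T | subgraph F H && isomorphic G F]%SET.
  by rewrite inE hGH isomorphic_refl.
have : F \in [set F : kgraph k T | subgraph F H && isomorphic G F]%SET.
  by rewrite inE FH GF.
by rewrite hK !inE => /eqP -> /eqP.
Qed.

(** A second edge of H would carry a second copy of G, with the only edge of G placed there and its
    isolated vertices among the other vertices of H. This keeps one-edge G out of the case that
    costs a logarithm. *)
Lemma single_edge_unique : (0 < k)%N -> #|eset G| = 1%N -> #|eset H| = 1%N.
Proof.
move=> k0 /eqP/cards1P[e eG].
suff -> : eset H = [set e]%SET by rewrite cards1.
apply/finset.setP => e'; rewrite inE; apply/idP/eqP => [e'H|->]; last first.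
  by case/andP: hGH => _ /fintype.subsetP; apply; rewrite eG inE.
have eGe : e \in eset G by rewrite eG inE.
have [eV ek] := kgraphP eGe; have [e'V e'k] := kgraphP e'H.
have VGH : vset G \subset vset H by case/andP: hGH.
have [x0 _] : exists x, x \in e by apply/set0Pn; rewrite -cards_eq0 ek -lt0n.
(* With the edge listed first in both lists, sending the i-th entry of [L] to the i-th entry of [L']
   maps [e] onto [e'], and it stays inside H because G has no more vertices than H. *)
pose L := enum e ++ enum (vset G :\: e); pose L' := enum e' ++ enum (vset H :\: e').
have memL x : (x \in L) = (x \in vset G).
  rewrite mem_cat !mem_enum inE.
  by have [/(fintype.subsetP eV) ->|] := boolP (x \in e).
have memL' x : (x \in L') = (x \in vset H).
  rewrite mem_cat !mem_enum inE.
  by have [/(fintype.subsetP e'V) ->|] := boolP (x \in e').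
have uL : uniq L.
  rewrite cat_uniq !enum_uniq /= andbT; apply/hasPn => x.
  by rewrite !mem_enum inE => /andP[].
have uL' : uniq L'.
  rewrite cat_uniq !enum_uniq /= andbT; apply/hasPn => x.
  by rewrite !mem_enum inE => /andP[].
have sL : (size L <= size L')%N.
  by apply: uniq_leq_size => // x; rewrite memL memL'; exact/fintype.subsetP.
have [||s hs] := @perm_extend nat T (nth x0 L) (nth x0 L') (iota 0 (size L)).
- move=> i j; rewrite !mem_iota /= !add0n => iL jL /eqP.
  by rewrite nth_uniq // => /eqP.
- move=> i j; rewrite !mem_iota /= !add0n => iL jL /eqP.
  by rewrite nth_uniq ?(leq_trans _ sL) // => /eqP.
have {}hs i : (i < size L)%N -> s (nth x0 L i) = nth x0 L' i.
  by move=> iL; apply: hs; rewrite mem_iota.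
have si : {in vset G &, injective s} by move=> x y _ _; exact: perm_inj.
have se : s @: e = e'.
  apply/eqP; rewrite eqEcard card_imset ?ek ?e'k ?leqnn ?andbT; last exact: perm_inj.
  apply/fintype.subsetP => y /imsetP[x xe ->{y}].
  have xi : (index x (enum e) < k)%N by rewrite -ek cardE index_mem mem_enum.
  have -> : x = nth x0 L (index x (enum e)).
    by rewrite nth_cat -cardE ek xi nth_index // mem_enum.
  rewrite hs; last by rewrite size_cat -cardE ek ltn_addr.
  by rewrite nth_cat -cardE e'k xi -mem_enum mem_nth // -cardE e'k.
suff eG' : gmap s G = G.
  have := eset_gmap si; rewrite eG' eG imset_set1 se => /finset.setP/(_ e').
  by rewrite !inE eqxx => /eqP.
apply: unique_copy; last by apply: isomorphic_gmap => //; exact: isomorphic_refl.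
apply/andP; split.
  rewrite vset_gmap //; apply/fintype.subsetP => y /imsetP[x xG ->{y}].
  have xL : (index x L < size L)%N by rewrite index_mem memL.
  rewrite -[x](nth_index x0 (s := L)) ?memL // hs // -memL' mem_nth //.
  exact: leq_trans sL.
by rewrite eset_gmap // eG imset_set1 se finset.sub1set.
Qed.

End UniqueCopy.

Section RandomGraph.
Context {R : realType}.
Variables (k n : nat) (p : R).
Hypothesis hp : 0 <= p <= 1.

Definition ksets : seq {set 'I_n} := enum [pred e : {set 'I_n} | #|e| == k].

Lemma ksets_uniq : uniq ksets.
Proof. exact: enum_uniq. Qed.

Lemma eset_ksets (K : kgraph k 'I_n) : {subset eset K <= ksets}.
Proof. by move=> e /kgraphP[_ ek]; rewrite mem_enum inE ek. Qed.

(** The mass vanishes unless the vertex set is all of ['I_n], so [X] need be a function of the edge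
    set only there; the coins are the [k]-subsets. *)
Lemma gnp_expect_bexp (f : {set {set 'I_n}} -> R) (X : kgraph k 'I_n -> R) :
  (forall K, vset K = [set: 'I_n]%SET -> X K = f (eset K)) ->
  gnp_expect p X = bexp p ksets f.
Proof.
move=> Xf; rewrite bexp_sumE ?ksets_uniq // /gnp_expect.
rewrite (bigID (fun K : kgraph k 'I_n => vset K == [set: 'I_n]%SET)) /=.
rewrite [X in _ + X]big1 ?addr0; last first.
  by move=> K /negbTE; rewrite /gnp_mass => ->; rewrite !mul0r.
pose h (S : {set {set 'I_n}}) : kgraph k 'I_n := insubd (kgraph0 k 'I_n) ([set: 'I_n]%SET, S).
have hE (S : {set {set 'I_n}}) : S \subset [set x in ksets]%SET ->
    kgraph_val (h S) = ([set: 'I_n]%SET, S).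
  move=> /fintype.subsetP Sk; apply: (@insubdK _ _ (kgraph k 'I_n)).
  apply/forallP => e; apply/implyP => /= /Sk; rewrite inE mem_enum inE => ->.
  by rewrite finset.subsetT.
have eS (K : kgraph k 'I_n) : eset K \subset [set x in ksets]%SET.
  by apply/fintype.subsetP => e /eset_ksets; rewrite inE.
rewrite (reindex_onto h (fun K => eset K)) /=; last first.
  move=> K /eqP KT; apply: kgraph_eq; first by rewrite /vset hE.
  by rewrite [LHS]/eset hE.
apply: eq_big => [S|S /andP[/eqP hv /eqP he]].
  apply/andP/idP => [[_ /eqP <-]//|Sk].
  by rewrite /vset /eset hE.
rewrite Xf // /gnp_mass hv eqxx mul1r he; congr (_ * _).
by rewrite /ksets big_enum.
Qed.

Lemma gnp_prob_bexp (a : {set {set 'I_n}} -> bool) (A : pred (kgraph k 'I_n)) :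
  (forall K, vset K = [set: 'I_n]%SET -> A K = a (eset K)) ->
  gnp_prob p A = bexp p ksets (fun S => (a S)%:R).
Proof.
move=> Aa; rewrite -(gnp_expect_bexp (X := fun K => (A K)%:R)); last first.
  by move=> K /Aa ->.
rewrite /gnp_prob /gnp_expect big_mkcond; apply: eq_bigr => K _.
by case: (A K); rewrite ?mulr1 ?mulr0.
Qed.

Variable T : finType.
Implicit Types J H G : kgraph k T.

(** On the full vertex set X_J depends on the edges alone, which makes it a counting family over the
    coins. *)
Definition ecnt J : {set {set 'I_n}} -> R := cnt (kcopies 'I_n J) (@eset k 'I_n).

Lemma copies_cnt J (K : kgraph k 'I_n) : vset K = [set: 'I_n]%SET ->
  copies R J K = ecnt J (eset K).
Proof.
move=> KT; rewrite /copies /ecnt /cnt /ncopies -sum1_card natr_sum big_mkcond [RHS]big_mkcond.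
apply: eq_bigr => F _; rewrite !inE /subgraph KT finset.subsetT /=.
by case: (isomorphic _ _); rewrite ?andbF //= andbT; case: (_ \subset _).
Qed.

Lemma kcopies_card_eset J F : F \in kcopies 'I_n J -> #|eset F| = #|eset J|.
Proof. by rewrite inE; exact: isomorphic_card. Qed.

Lemma mean_copiesE J :
  mean_copies J n p = #|kcopies 'I_n J|%:R * p ^+ #|eset J|.
Proof.
rewrite /mean_copies (gnp_expect_bexp (f := ecnt J)); last exact: copies_cnt.
apply: bexp_cnt ksets_uniq _ _ => F; first by move=> _; exact: eset_ksets.
exact: kcopies_card_eset.
Qed.

Lemma gnp_prob_copies H (a : R) :
  gnp_prob p (fun K : kgraph k 'I_n => copies R H K <= a)%R =
  bexp p ksets (fun S => (ecnt H S <= a)%R%:R).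
Proof. by apply: gnp_prob_bexp => K KT; rewrite copies_cnt. Qed.

(** Given a copy of J, the summand is the expected number of copies of H over it once its edges are
    present; [ncopies J H] counts the places J can take in such a copy. The sum runs over the J
    inside one fixed copy of H and serves as the dependency bound [D]. *)
Definition overlap_bound H : R :=
  \sum_(J : kgraph k T | subgraph J H && (0 < #|eset J|)%N)
    (ncopies J H)%:R * (mean_copies H n p / mean_copies J n p).

(** What [F2] shares with [F1], common vertices included, is the image of some J in H. Summing over
    every J whose image lies in [F2] only overcounts, and exchanging the sums leaves the number of
    copies of H over a given copy of J. *)
Lemma overlap_le H F1 : 0 < p -> F1 \in kcopies 'I_n H ->
  \sum_(F2 in kcopies 'I_n H | ~~ [disjoint eset F2 & eset F1])
    p ^+ #|eset F2 :\: eset F1| <= overlap_bound H.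
Proof.
move=> p0 F1H; have := F1H; rewrite inE => /isomorphicP[f fi eF1].
have cH (F2 : kgraph k 'I_n) : F2 \in kcopies 'I_n H -> ~~ [disjoint eset F2 & eset F1] ->
  exists J, [/\ subgraph J H, (0 < #|eset J|)%N, subgraph (gmap f J) F2 &
    #|eset F2 :\: eset F1| = (#|eset H| - #|eset J|)%N].
  move=> F2H; rewrite -setI_eq0 -cards_eq0 -lt0n => F12.
  have kgE : is_kgraph k (vset F2 :&: vset F1, eset F2 :&: eset F1).
    apply/forallP => e; apply/implyP; rewrite inE => /= /andP[e2 e1].
    have [h1 ek] := kgraphP e1; have [h2 _] := kgraphP e2.
    by rewrite finset.subsetI h1 h2 ek eqxx.
  have sub1 : subgraph (KGraph kgE) (gmap f H).
    by rewrite -eF1; apply/andP; split; exact: finset.subsetIr.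
  have [J JH eJ] := gmap_surj fi sub1; have fiJ := subgraph_inj_on fi JH.
  have cJ : #|eset J| = #|eset F2 :&: eset F1| by rewrite -(card_eset_gmap fiJ) -eJ.
  exists J; split => //; first by rewrite cJ.
    by rewrite -eJ; apply/andP; split; exact: finset.subsetIl.
  by rewrite cardsD (kcopies_card_eset F2H) cJ.
apply: (@le_trans _ _ (\sum_(F2 in kcopies 'I_n H)
  \sum_(J : kgraph k T | subgraph J H && (0 < #|eset J|)%N)
     (subgraph (gmap f J) F2)%:R * p ^+ (#|eset H| - #|eset J|))).
  rewrite big_mkcondr; apply: ler_sum => F2 F2H.
  have sum0 (P : pred (kgraph k T)) : 0 <= \sum_(J : kgraph k T | P J)
     (subgraph (gmap f J) F2)%:R * p ^+ (#|eset H| - #|eset J|).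
    by apply: sumr_ge0 => J _; rewrite mulr_ge0 // exprn_ge0 // ltW.
  case: ifP => // /(cH _ F2H)[J [JH J0 JF2 ->]].
  rewrite (bigD1 J) /=; last by rewrite JH.
  by rewrite JF2 mul1r lerDl.
rewrite exchange_big /=; apply: ler_sum => J /andP[JH J0].
have fiJ := subgraph_inj_on fi JH.
have JC : gmap f J \in kcopies 'I_n J.
  by rewrite inE; apply: isomorphic_gmap => //; exact: isomorphic_refl.
have NJ : (0 < #|kcopies 'I_n J|)%N by apply/card_gt0P; exists (gmap f J).
have eJH : (#|eset J| <= #|eset H|)%N by case/andP: JH => _; exact: subset_leq_card.
rewrite -mulr_suml -natr_sum.
have -> : (\sum_(F2 in kcopies 'I_n H) (subgraph (gmap f J) F2 : nat) =
    #|supercopies H (gmap f J)|)%N.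
  rewrite -sum1_card big_mkcond [RHS]big_mkcond; apply: eq_bigr => K _.
  by rewrite !inE; case: (isomorphic _ _) => //=; case: (subgraph _ _).
have := card_supercopies H JC => /(congr1 (fun x => x%:R : R)); rewrite !natrM => hc.
have NJ0 : #|kcopies 'I_n J|%:R != 0 :> R by rewrite pnatr_eq0 -lt0n.
have -> : #|supercopies H (gmap f J)|%:R =
    #|kcopies 'I_n H|%:R * (ncopies J H)%:R / #|kcopies 'I_n J|%:R :> R.
  by rewrite -hc mulfK.
rewrite !mean_copiesE le_eqVlt; apply/orP; left; apply/eqP.
rewrite -[in RHS](subnK eJH) exprD.
have pJ : p ^+ #|eset J| != 0 by rewrite expf_neq0 // gt_eqF.
move: pJ NJ0; move: (p ^+ _) (p ^+ _) (_%:R) (_%:R) (_%:R) => a b c x y b0 y0.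
by field; rewrite b0 y0.
Qed.

Lemma mean_copies_ge0 J : 0 <= mean_copies J n p.
Proof. by rewrite mean_copiesE mulr_ge0 // exprn_ge0 //; case/andP: hp. Qed.

Section Extension.
Variables G H : kgraph k T.
Hypotheses (hGH : subgraph G H) (hcopy : ncopies G H = 1%N).

(** Each copy of H contains exactly one copy of G, so the copies of H split into classes over the
    copies of G. *)
Lemma sum_supercopies (a : kgraph k 'I_n -> R) :
  \sum_(F in kcopies 'I_n H) a F =
  \sum_(F' in kcopies 'I_n G) \sum_(F in supercopies H F') a F.
Proof.
rewrite [RHS](eq_bigr (fun F' => \sum_(F in kcopies 'I_n H) (subgraph F' F)%:R * a F)); last first.
  move=> F' _; rewrite big_mkcond [RHS]big_mkcond; apply: eq_bigr => K _.
  by rewrite !inE; case: (isomorphic _ _) => //=; case: (subgraph _ _); rewrite ?mul1r ?mul0r.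
rewrite exchange_big /=; apply: eq_bigr => K.
rewrite inE => /isomorphicP[f fi eK]; rewrite -mulr_suml -natr_sum.
suff -> : (\sum_(F' in kcopies 'I_n G) (subgraph F' K : nat) = 1)%N by rewrite mul1r.
rewrite -hcopy -(ncopies_gmap G fi) -eK /ncopies -sum1_card big_mkcond [RHS]big_mkcond.
apply: eq_bigr => F' _; rewrite !inE.
by case: (isomorphic _ _) => //=; case: (subgraph _ _).
Qed.

Lemma card_supercopies_ratio F' : 0 < p -> F' \in kcopies 'I_n G ->
  #|supercopies H F'|%:R * p ^+ (#|eset H| - #|eset G|) =
  mean_copies H n p / mean_copies G n p.
Proof.
move=> p0 F'G; have := card_supercopies H F'G => /(congr1 (fun x => x%:R : R)).
rewrite hcopy muln1 !natrM => hc.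
have NG : (0 < #|kcopies 'I_n G|)%N by apply/card_gt0P; exists F'.
have NG0 : #|kcopies 'I_n G|%:R != 0 :> R by rewrite pnatr_eq0 -lt0n.
have eGH : (#|eset G| <= #|eset H|)%N by case/andP: hGH => _; exact: subset_leq_card.
rewrite !mean_copiesE -hc -[in RHS](subnK eGH) exprD.
have pJ : p ^+ #|eset G| != 0 by rewrite expf_neq0 // gt_eqF.
move: pJ NG0; move: (p ^+ _) (p ^+ _) (_%:R) (_%:R) => a b x y b0 y0.
by field; rewrite b0 y0.
Qed.

Lemma mean_copies_eq0 : mean_copies G n p = 0 -> mean_copies H n p = 0.
Proof.
have eGH : (#|eset G| <= #|eset H|)%N by case/andP: hGH => _; exact: subset_leq_card.
rewrite !mean_copiesE => /eqP; rewrite mulf_eq0 pnatr_eq0 expf_eq0 => /orP[/eqP NG|/andP[eG /eqP ->]].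
  have := sum_supercopies (fun=> 1); rewrite sumr_const => ->.
  rewrite big1 ?mul0r // => F' F'G; move: NG => /eqP; rewrite cards_eq0 => /eqP NG.
  by rewrite NG inE in F'G.
by rewrite expr0n gtn_eqF ?mulr0 // (leq_trans eG).
Qed.

Lemma ecnt_eq0 S : ecnt G S = 0 -> ecnt H S = 0.
Proof.
rewrite /ecnt /cnt => /eqP; rewrite psumr_eq0 // => /allP hG.
rewrite sum_supercopies big1 // => F' F'G; rewrite big1 // => F.
rewrite !inE => /andP[_ /andP[_ F'F]].
have := hG F'; rewrite mem_index_enum F'G => /(_ isT) /=.
rewrite pnatr_eq0 eqb0 => /negbTE F'S.
have [FS|//] := boolP (eset F \subset S).
by rewrite (fintype.subset_trans F'F FS) in F'S.
Qed.

(* On the presence of a copy of G, the indicator of a larger copy of H only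
   lowers an antitone function further. *)
Lemma bexp_ecnt_antitone (h : {set {set 'I_n}} -> R) : 0 < p -> antitone h ->
  bexp p ksets (fun S => ecnt H S * h S) <=
  mean_copies H n p / mean_copies G n p * bexp p ksets (fun S => ecnt G S * h S).
Proof.
move=> p0 hA.
have eGH : (#|eset G| <= #|eset H|)%N by case/andP: hGH => _; exact: subset_leq_card.
have lhs J : bexp p ksets (fun S => ecnt J S * h S) =
    \sum_(F in kcopies 'I_n J) bexp p ksets (fun S => (eset F \subset S)%:R * h S).
  rewrite -bexp_sum; apply: eq_bexp => S _; rewrite /ecnt /cnt mulr_suml //.
rewrite !lhs sum_supercopies mulr_sumr; apply: ler_sum => F' F'G.
rewrite -(card_supercopies_ratio p0 F'G) -mulrA mulr_natl -sumr_const.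
apply: ler_sum => F; rewrite inE => /andP[FH /andP[_ F'F]].
rewrite !bexp_subset ?ksets_uniq //; try exact: eset_ksets.
rewrite (kcopies_card_eset F'G) (kcopies_card_eset FH) mulrA -exprD subnK //.
apply: ler_wpM2l; first by rewrite exprn_ge0 // ltW.
by apply: bexp_le => // S _; apply: hA; exact: finset.setSU.
Qed.

(** A copy of H and the copy of G below it then have the same edges, so X_H is a deterministic
    multiple of X_G and the tail event passes over without loss. *)
Lemma ecnt_same_size S : 0 < p -> #|eset H| = #|eset G| ->
  ecnt H S = mean_copies H n p / mean_copies G n p * ecnt G S.
Proof.
move=> p0 eHG; rewrite /ecnt /cnt sum_supercopies mulr_sumr; apply: eq_bigr => F' F'G.
rewrite -(card_supercopies_ratio p0 F'G) eHG subnn expr0 mulr1 mulr_natl -sumr_const.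
apply: eq_bigr => F; rewrite inE => /andP[FH /andP[_ F'F]].
have -> // : eset F = eset F'.
apply/esym/eqP; rewrite eqEcard F'F.
by rewrite (kcopies_card_eset F'G) (kcopies_card_eset FH) eHG leqnn.
Qed.

End Extension.
End RandomGraph.


(** * Rate function and change of measure *)

Section RateFunction.
Context {R : realType}.
Implicit Types x y u s d e : R.

Lemma ln_le_sub1 x : 0 < x -> ln x <= x - 1.
Proof. by move=> x0; have := @le_ln1Dx R (x - 1); rewrite subrKC; apply; lra. Qed.

(* From [ln x^-1 = 2 * ln (sqrt x)^-1 <= 2 * ((sqrt x)^-1 - 1)]. *)
Lemma phi_ge_sqrt e : 0 < e <= 1 -> (1 - Num.sqrt (1 - e)) ^+ 2 <= phi (- e).
Proof.
move=> /andP[e0 e1]; rewrite /phi opprK.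
have [x0|x0] := leP (1 - e) 0.
  have -> : 1 - e = 0 by lra.
  by rewrite sqrtr0 mul0r add0r subr0 expr1n; lra.
set r := Num.sqrt (1 - e); have r0 : 0 < r by rewrite sqrtr_gt0.
have rr : 1 - e = r ^+ 2 by rewrite sqr_sqrtr // ltW.
have hln : ln (1 - e) = - (2 * ln r^-1).
  by rewrite rr lnXn // lnV ?posrE // mulrN opprK mulr_natl.
have := ln_le_sub1 (x := r^-1); rewrite invr_gt0 => /(_ r0) h.
have h2 : r * r^-1 = 1 by rewrite divff // gt_eqF.
have : 0 <= r ^+ 2 * (r^-1 - 1 - ln r^-1) by rewrite mulr_ge0 ?sqr_ge0 // subr_ge0.
have -> : r ^+ 2 * (r^-1 - 1 - ln r^-1) = r * (r * r^-1) - r ^+ 2 - r ^+ 2 * ln r^-1 by ring.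
rewrite h2 hln rr; lra.
Qed.

(** Follows from [phi_ge_sqrt], since [e = (1 - r) * (1 + r) <= 2 * (1 - r)] for [r] the square root
    of [1 - e]. *)
Lemma phi_ge_sqr e : 0 < e <= 1 -> e ^+ 2 / 4 <= phi (- e).
Proof.
move=> he; apply: le_trans (phi_ge_sqrt he); case/andP: he => e0 e1.
set r := Num.sqrt (1 - e); have r0 : 0 <= r by exact: sqrtr_ge0.
have rr : 1 - e = r ^+ 2 by rewrite sqr_sqrtr //; lra.
have -> : e = (1 - r) * (1 + r) by rewrite -[e]opprK -[- e](addKr 1) rr; ring.
have r1 : r <= 1 by rewrite expr2 in rr; nra.
rewrite exprMn -mulrA -[leRHS]mulr1; apply: ler_wpM2l; first exact: sqr_ge0.
nra.
Qed.

(** Convexity of x -> [phi (- x)], whose derivative at [d] is [- ln (1 - d)]. *)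
Lemma phi_tangent e d : 0 < e -> e <= d -> d < 1 ->
  phi (- d) <= phi (- e) + (d - e) * (- ln (1 - d)).
Proof.
move=> e0 ed d1; rewrite /phi !opprK.
have x0 : 0 < 1 - e by lra.
have y0 : 0 < 1 - d by lra.
have := ln_le_sub1 (x := (1 - d) / (1 - e)); rewrite divr_gt0 // => /(_ isT).
rewrite ln_div ?posrE // => h.
have : 0 <= (1 - e) * ((1 - d) / (1 - e) - 1 - (ln (1 - d) - ln (1 - e))).
  by apply: mulr_ge0; [exact: ltW | rewrite subr_ge0].
have -> : (1 - e) * ((1 - d) / (1 - e) - 1 - (ln (1 - d) - ln (1 - e))) =
  (1 - d) - (1 - e) - (1 - e) * (ln (1 - d) - ln (1 - e)) by field; rewrite gt_eqF.
lra.
Qed.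

Lemma expR_le_quad u : 0 <= u -> u <= 1 / 2 -> expR u <= 1 + u + 2 * u ^+ 2.
Proof.
move=> u0 u1; have := expR_ge1Dx (- u); rewrite expRN => h.
have h1 : 0 < 1 - u by lra.
have : expR u <= (1 - u)^-1 by rewrite -[expR u]invrK lef_pV2 ?posrE ?invr_gt0 ?expR_gt0.
move=> /le_trans; apply; rewrite -div1r ler_pdivrMr //.
have : 0 <= u ^+ 2 * (1 - 2 * u) by rewrite mulr_ge0 ?sqr_ge0 //; lra.
lra.
Qed.

Lemma expRN_le_quad u : 0 <= u -> expR (- u) <= 1 - u + 2 * u ^+ 2.
Proof.
move=> u0; have h := expR_ge1Dx u; rewrite expRN.
have h1 : 0 < 1 + u by lra.
have : (expR u)^-1 <= (1 + u)^-1 by rewrite lef_pV2 ?posrE ?expR_gt0.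
move=> /le_trans; apply; rewrite -div1r ler_pdivrMr //.
have : 0 <= u ^+ 2 * (1 + 2 * u) by rewrite mulr_ge0 ?sqr_ge0 //; lra.
lra.
Qed.

(** Brings Janson's exponent at [D = 1 + kap] to the shape of the Harris bound, so that the two
    estimates of the Laplace transform differ only in the sign of an error [kap * s ^+ 2]. *)
Lemma laplace_exponent_perturb (s kap : R) : 0 <= s -> 0 < kap ->
  1 - expR (- s) - kap * s ^+ 2 <= (1 - expR (- (s * (1 + kap)))) / (1 + kap).
Proof.
move=> s0 k0; have k1 : 0 < 1 + kap by lra.
rewrite ler_pdivlMr //.
have -> : - (s * (1 + kap)) = - s + - (s * kap) by ring.
rewrite expRD; have sk0 : 0 <= s * kap by rewrite mulr_ge0 // ltW.
have h1 := expR_ge1Dx (- s); have hs := expR_gt0 (- s).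
have hs1 : expR (- s) <= 1 by rewrite expR_le1; lra.
have h2 : expR (- (s * kap)) <= 1 - s * kap + (s * kap) ^+ 2.
  have h := expR_ge1Dx (s * kap); rewrite expRN.
  have h3 : 0 < 1 + s * kap by lra.
  have : (expR (s * kap))^-1 <= (1 + s * kap)^-1 by rewrite lef_pV2 ?posrE ?expR_gt0.
  move=> /le_trans; apply; rewrite -div1r ler_pdivrMr //.
  have : 0 <= (s * kap) ^+ 2 * (s * kap) by rewrite mulr_ge0 ?sqr_ge0.
  lra.
have h4 : expR (- s) * expR (- (s * kap)) <= expR (- s) * (1 - s * kap + (s * kap) ^+ 2).
  by rewrite ler_pM2l.
have h5 : expR (- s) * (s * kap) ^+ 2 <= (s * kap) ^+ 2 by rewrite ler_piMl ?sqr_ge0.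
have h6 : 0 <= kap * (1 + s) * (expR (- s) - (1 - s)).
  by rewrite !mulr_ge0 ?subr_ge0 //; lra.
lra.
Qed.

End RateFunction.

Section Tilting.
Context {R : realType} {E : finType}.
Variables (p : R) (l : seq E) (X : {set E} -> R).
Hypothesis hp : 0 <= p <= 1.

Let M (s : R) := bexp p l (fun S => expR (- (s * X S))).

(** Three regimes of [X]: above [a] the weaker tilt [s - u] dominates, below [b] the stronger tilt
    [s + u] does, and in between the integrand is at most [expR (- (s * b))]. Upper bounds on the
    two outer terms leave a lower bound for the probability of [X <= a]. *)
Lemma laplace_split (s u a b : R) : 0 <= s -> 0 <= u ->
  M s <= M (s - u) * expR (- (u * a)) + M (s + u) * expR (u * b) +
         expR (- (s * b)) * bexp p l (fun S => (X S <= a)%R%:R).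
Proof.
move=> s0 u0; rewrite ![M _ * _]mulrC -!bexpZ -!bexpD; apply: bexp_le => // S _.
rewrite -!expRD.
have e1 := expR_ge0 (- (u * a) + - ((s - u) * X S)).
have e2 := expR_ge0 (u * b + - ((s + u) * X S)).
have [Xa|Xa] := leP (X S) a; last first.
  rewrite mulr0 addr0; apply: ler_wpDr => //; rewrite ler_expR.
  have : 0 <= u * (X S - a) by rewrite mulr_ge0 // subr_ge0 ltW.
  lra.
rewrite mulr1; have [Xb|Xb] := ltP (X S) b; last first.
  apply: ler_wpDl; first exact: addr_ge0.
  by rewrite ler_expR lerN2 ler_wpM2l.
apply: ler_wpDr; first exact: expR_ge0.
apply: ler_wpDl => //; rewrite ler_expR.
have : 0 <= u * (b - X S) by rewrite mulr_ge0 // subr_ge0 ltW.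
lra.
Qed.

Lemma expRN2_le4 : expR (- 2) <= 1 / 4 :> R.
Proof.
rewrite expRN div1r lef_pV2 ?posrE ?expR_gt0 //.
have -> : 2 = 1 + 1 :> R by ring.
by rewrite expRD; have := expR_ge1Dx (1 : R); nra.
Qed.

(* The measure tilted by [expR (- (s * X))] with [s = - ln (1 - (1 + 2z)e)]
   concentrates on the window [(1 - (1 + 3z)e)mu <= X <= (1 - (1 + z)e)mu]. *)
Lemma tilted_lower_bound (mu kap eta z e : R) :
  0 <= mu -> 0 < eta <= 1 -> 0 < z <= 1 -> 0 < e <= 1 -> 0 <= kap ->
  eta <= 1 - (1 + 2 * z) * e ->
  kap * 512 <= z ^+ 2 * eta ^+ 2 ->
  32 <= z ^+ 2 * (e ^+ 2 * mu) ->
  (forall s, 0 <= s -> expR (- (mu * (1 - expR (- s) + kap * s ^+ 2))) <= M s) ->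
  (forall s, 0 <= s -> M s <= expR (- (mu * (1 - expR (- s) - kap * s ^+ 2)))) ->
  expR (- (mu * (phi (- e) * (1 + 40 * z / eta)))) / 2 <=
  bexp p l (fun S => (X S <= (1 - (1 + z) * e) * mu)%R%:R).
Proof.
move=> mu0 /andP[eta0 eta1] /andP[z0 z1] /andP[e0 e1] kap0 heta hkap hmu Mlow Mup.
(* The shift [u = z * e / 4] minimises [2 * u ^+ 2 - z * e * u], which bounds the leading exponent
   of each tail per unit of [mu]; the minimum is [- (z ^+ 2 * e ^+ 2 / 8)]. *)
pose e2 := (1 + 2 * z) * e; pose s := - ln (1 - e2); pose u := z * e / 4.
have ez : 0 < z * e by rewrite mulr_gt0.
have y0 : 0 < 1 - e2 by rewrite /e2; lra.
have e2e : e <= e2 by rewrite /e2; lra.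
have es : expR (- s) = 1 - e2 by rewrite opprK lnK ?posrE.
have u0 : 0 <= u by rewrite /u; lra.
have uh : u <= 1 / 2 by rewrite /u; nra.
have s_ge : e2 <= s by have := ln_le_sub1 y0; rewrite /s; lra.
have su : u <= s by apply: le_trans s_ge; rewrite /u /e2; nra.
have s0 : 0 <= s by apply: le_trans su.
have s_le : s * eta <= 3 * e.
  have := ln_le_sub1 (x := (1 - e2)^-1); rewrite invr_gt0 => /(_ y0).
  rewrite lnV ?posrE // -/s => h.
  have h1 : s * (1 - e2) <= e2.
    have : s * (1 - e2) <= ((1 - e2)^-1 - 1) * (1 - e2) by rewrite ler_pM2r.
    by have -> : ((1 - e2)^-1 - 1) * (1 - e2) = e2 by field; rewrite gt_eqF.
  apply: (@le_trans _ _ (s * (1 - e2))); first by rewrite ler_wpM2l.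
  by apply: (le_trans h1); rewrite /e2; nra.
have su_le : (s + u) * eta <= 4 * e.
  have : u * eta <= e by rewrite /u; nra.
  lra.
(* Origin of 512: given [(s + u) * eta <= 4 * e], the errors of the Laplace bounds use up at most
   half of the gain [z ^+ 2 * e ^+ 2 / 8]. *)
have hk : 2 * kap * (s + u) ^+ 2 <= z ^+ 2 * e ^+ 2 / 16.
  have h1 : ((s + u) * eta) ^+ 2 <= (4 * e) ^+ 2.
    by rewrite ler_sqr ?nnegrE // ?mulr_ge0 ?addr_ge0 //; lra.
  have h2 : kap * 512 * (s + u) ^+ 2 <= z ^+ 2 * eta ^+ 2 * (s + u) ^+ 2.
    by rewrite ler_wpM2r ?sqr_ge0.
  have h3 : z ^+ 2 * ((s + u) * eta) ^+ 2 <= z ^+ 2 * (4 * e) ^+ 2.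
    by rewrite ler_wpM2l ?sqr_ge0.
  lra.
have s2 : s ^+ 2 <= (s + u) ^+ 2 by rewrite ler_sqr ?nnegrE //; lra.
have su2 : (s - u) ^+ 2 <= (s + u) ^+ 2 by rewrite ler_sqr ?nnegrE //; lra.
have ks2 : kap * s ^+ 2 <= kap * (s + u) ^+ 2 by rewrite ler_wpM2l.
have ksu2 : kap * (s - u) ^+ 2 <= kap * (s + u) ^+ 2 by rewrite ler_wpM2l.
pose a := (1 - (1 + z) * e) * mu; pose b := (1 - (1 + 3 * z) * e) * mu.
pose L := expR (- (mu * (1 - expR (- s) + kap * s ^+ 2))).
(* The other half of the gain, times [mu], is at least 2 by the hypothesis with 32. So each tail
   takes at most a quarter of [L], and the window keeps a half. *)
have quarter x : x <= - (z ^+ 2 * e ^+ 2 / 16) -> expR (mu * x) <= 1 / 4.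
  move=> hx; apply: le_trans expRN2_le4; rewrite ler_expR.
  apply: (@le_trans _ _ (mu * - (z ^+ 2 * e ^+ 2 / 16))); first by rewrite ler_wpM2l.
  lra.
have t1 : M (s - u) * expR (- (u * a)) <= L * (1 / 4).
  have su0 : 0 <= s - u by lra.
  apply: le_trans (ler_wpM2r (expR_ge0 _) (Mup _ su0)) _.
  pose x := (1 - e2) * (expR u - 1) - u * (1 - (1 + z) * e) + kap * (s - u) ^+ 2 + kap * s ^+ 2.
  have -> : expR (- (mu * (1 - expR (- (s - u)) - kap * (s - u) ^+ 2))) * expR (- (u * a)) =
            L * expR (mu * x).
    rewrite /L -!expRD; congr expR; rewrite opprB addrC expRD es /x /a; ring.
  rewrite ler_pM2l ?expR_gt0 //; apply: quarter.
  have h1 : (1 - e2) * (expR u - 1) <= (1 - e2) * (u + 2 * u ^+ 2).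
    by rewrite ler_pM2l //; have := expR_le_quad u0 uh; lra.
  have h2 : (1 - e2) * (u ^+ 2) <= u ^+ 2 by rewrite ler_piMl ?sqr_ge0 //; lra.
  have h3 : (1 - e2) * u - u * (1 - (1 + z) * e) = - (z * e * u) by rewrite /e2; ring.
  have h4 : - (z * e * u) + 2 * u ^+ 2 = - (z ^+ 2 * e ^+ 2 / 8) by rewrite /u; field.
  rewrite /x; lra.
have t2 : M (s + u) * expR (u * b) <= L * (1 / 4).
  have su0 : 0 <= s + u by lra.
  apply: le_trans (ler_wpM2r (expR_ge0 _) (Mup _ su0)) _.
  pose x := (1 - e2) * (expR (- u) - 1) + u * (1 - (1 + 3 * z) * e) + kap * (s + u) ^+ 2 + kap * s ^+ 2.
  have -> : expR (- (mu * (1 - expR (- (s + u)) - kap * (s + u) ^+ 2))) * expR (u * b) =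
            L * expR (mu * x).
    rewrite /L -!expRD; congr expR; rewrite opprD expRD es /x /b; ring.
  rewrite ler_pM2l ?expR_gt0 //; apply: quarter.
  have h1 : (1 - e2) * (expR (- u) - 1) <= (1 - e2) * (- u + 2 * u ^+ 2).
    by rewrite ler_pM2l //; have := expRN_le_quad u0; lra.
  have h2 : (1 - e2) * (u ^+ 2) <= u ^+ 2 by rewrite ler_piMl ?sqr_ge0 //; lra.
  have h3 : - ((1 - e2) * u) + u * (1 - (1 + 3 * z) * e) = - (z * e * u) by rewrite /e2; ring.
  have h4 : - (z * e * u) + 2 * u ^+ 2 = - (z ^+ 2 * e ^+ 2 / 8) by rewrite /u; field.
  rewrite /x; lra.
have main := laplace_split a b s0 u0.
have LM := Mlow s s0; rewrite -/L in LM.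
set P := bexp _ _ _ in main *.
have hP : L / 2 * expR (s * b) <= P.
  rewrite -ler_pdivlMr ?expR_gt0 // mulrC -expRN; lra.
apply: le_trans hP; rewrite [leRHS]mulrAC /L -expRD ler_pM2r ?invr_gt0 //.
rewrite ler_expR es.
have e21 : e2 < 1 by lra.
have tang := phi_tangent e0 e2e e21; rewrite -/s in tang.
have phi2 : phi (- e2) = e2 - s * (1 - e2) by rewrite /phi opprK /s; ring.
have e01 : 0 < e <= 1 by rewrite e0.
have phie := phi_ge_sqr e01.
have hs : s <= 3 * e / eta by rewrite ler_pdivlMr.
have ee : 0 <= e ^+ 2 / eta by rewrite divr_ge0 ?sqr_ge0 // ltW.
have hze : z * e * s <= 3 * z * (e ^+ 2 / eta).
  have -> : 3 * z * (e ^+ 2 / eta) = z * e * (3 * e / eta) by field; rewrite gt_eqF.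
  by rewrite ler_pM2l.
have hks : kap * s ^+ 2 <= z * (e ^+ 2 / eta).
  apply: (@le_trans _ _ (z ^+ 2 * e ^+ 2 / 32)); first by lra.
  have -> : z ^+ 2 * e ^+ 2 / 32 = z * (e ^+ 2 * (z / 32)) by field.
  rewrite ler_pM2l // ler_wpM2l ?sqr_ge0 //.
  rewrite -[eta^-1]div1r ler_pdivlMr //; nra.
(* The tangent bound costs [2 * z * e * s] and the lower end of the window [z * e * s], together at
   most 9 units of [z * (e ^+ 2 / eta)]; [kap * s ^+ 2] is at most one more. The bound [e ^+ 2 / 4]
   on [phi] turns 10 into 40. *)
have hphi : 10 * z * (e ^+ 2 / eta) <= phi (- e) * (40 * z / eta).
  have -> : 10 * z * (e ^+ 2 / eta) = e ^+ 2 / 4 * (40 * z / eta) by field; rewrite gt_eqF.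
  apply: ler_wpM2r => //; apply: divr_ge0; lra.
have -> : - (mu * (1 - (1 - e2) + kap * s ^+ 2)) + s * b =
    - (mu * (phi (- e2) + z * e * s + kap * s ^+ 2)).
  rewrite phi2 /b /e2; ring.
have d : e2 - e = 2 * (z * e) by rewrite /e2; ring.
rewrite d -mulrA in tang; rewrite lerN2 ler_wpM2l // mulrDr mulr1.
clear - tang hze hks hphi; lra.
Qed.

End Tilting.


(** * Bounds for fixed n *)

Section FixedOrder.
Context {R : realType}.
Implicit Types (k n : nat) (T : finType) (p : R).

Lemma gnp_lower_tail_le k n T p (H : kgraph k T) (D eps : R) :
  0 < p -> p <= 1 ->
  0 < D -> overlap_bound n p H <= D ->
  0 < eps <= 1 ->
  gnp_prob p (fun K : kgraph k 'I_n => copies R H K <= (1 - eps) * mean_copies H n p) <=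
  expR (- (mean_copies H n p / D * phi (- eps))).
Proof.
move=> p_gt0 p_le1; have hp : 0 <= p <= 1 by rewrite ltW.
move=> D0 hD heps; rewrite gnp_prob_copies mean_copiesE.
apply: (lower_tail_le hp (ksets_uniq k n)) => //.
- by move=> F _; exact: eset_ksets.
- exact: kcopies_card_eset.
- by move=> F FH; apply: le_trans hD; exact: overlap_le.
Qed.

Lemma exprn_le_base p m : 0 < p -> p <= 1 -> (1 <= m)%N -> p ^+ m <= p.
Proof. by move=> p_gt0 p_le1; case: m => // m _; rewrite exprS ler_piMr ?exprn_ile1 // ltW. Qed.

Lemma laplace_ecnt_ge k n T p (G : kgraph k T) (kap s : R) :
  0 < p -> p <= 1 -> (1 <= #|eset G|)%N ->
  p <= kap -> kap <= 1 / 4 -> 0 <= s ->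
  expR (- (mean_copies G n p * (1 - expR (- s) + kap * s ^+ 2))) <=
  bexp p (ksets k n) (fun S => expR (- (s * ecnt G S))).
Proof.
move=> p_gt0 p_le1 eG1; have hp : 0 <= p <= 1 by rewrite ltW.
move=> pk k4 s0; have qp := exprn_le_base p_gt0 p_le1 eG1; have qk := le_trans qp pk.
have := @laplace_lower R _ _ p _ _ _ _ hp (ksets_uniq k n)
  (fun F _ => @eset_ksets k n F) (@kcopies_card_eset k n T G) s s0 (le_trans qk k4).
apply: le_trans; rewrite -mean_copiesE ler_expR lerN2.
apply: ler_wpM2l; first exact: mean_copies_ge0.
by rewrite lerD2l mulrC; apply: ler_wpM2r; first exact: sqr_ge0.
Qed.

Lemma laplace_ecnt_le k n T p (G : kgraph k T) (kap s : R) :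
  0 < p -> p <= 1 ->
  0 < kap -> overlap_bound n p G <= 1 + kap ->
  0 <= s ->
  bexp p (ksets k n) (fun S => expR (- (s * ecnt G S))) <=
  expR (- (mean_copies G n p * (1 - expR (- s) - kap * s ^+ 2))).
Proof.
move=> p_gt0 p_le1; have hp : 0 <= p <= 1 by rewrite ltW.
move=> k0 hD s0; have D0 : 0 < 1 + kap by lra.
have hD' F : F \in kcopies 'I_n G -> \sum_(F2 in kcopies 'I_n G |
   ~~ [disjoint eset F2 & eset F]) p ^+ #|eset F2 :\: eset F| <= 1 + kap.
  by move=> FG; apply: le_trans hD; exact: overlap_le.
have := @laplace_upper R _ _ p _ _ _ _ hp (ksets_uniq k n)
  (fun F _ => @eset_ksets k n F) (@kcopies_card_eset k n T G) (1 + kap) D0 hD' s s0.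
move=> /le_trans; apply; rewrite -mean_copiesE ler_expR lerN2.
apply: ler_wpM2l; first exact: mean_copies_ge0.
exact: laplace_exponent_perturb.
Qed.

Lemma antitone_ecnt_le k n T (G : kgraph k T) (a : R) :
  antitone (fun S : {set {set 'I_n}} => (ecnt G S <= a)%R%:R : R).
Proof.
move=> S S' SS'; rewrite ler_nat; have [h|//] := leP (ecnt G S') a.
suff -> : ecnt G S <= a by [].
apply: le_trans h; apply: ler_sum => F _; rewrite ler_nat.
by have [h|//] := boolP (eset F \subset S); rewrite (fintype.subset_trans h).
Qed.

(** Markov's inequality without dividing by the probability [PG] of X_G <= a: the mean of X_H on
    that event is at most EX_H / EX_G * a * PG and at least b * (PG - PH). The slack [z * eps]
    between the two thresholds becomes the factor. *)
Lemma copies_tail_transfer k n T p (G H : kgraph k T) (z eps : R) :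
  0 < p -> p <= 1 -> subgraph G H -> ncopies G H = 1%N ->
  0 < mean_copies G n p -> 0 < mean_copies H n p ->
  0 < z -> 0 < eps < 1 ->
  z * eps * bexp p (ksets k n) (fun S => (ecnt G S <= (1 - (1 + z) * eps) * mean_copies G n p)%R%:R) <=
  bexp p (ksets k n) (fun S => (ecnt H S <= (1 - eps) * mean_copies H n p)%R%:R).
Proof.
move=> p_gt0 p_le1 hGH hcopy muG_gt0 muH_gt0; have hp : 0 <= p <= 1 by rewrite ltW.
move=> z0 /andP[e0 e1].
set a := (1 - (1 + z) * eps) * mean_copies G n p; set b := (1 - eps) * mean_copies H n p.
set PG := bexp _ _ _; set PH := bexp _ _ _.
have b0 : 0 < b by rewrite mulr_gt0 // subr_gt0.
have PH0 : 0 <= PH by apply: bexp_ge0.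
have h1 := bexp_ecnt_antitone hp hGH hcopy p_gt0 (@antitone_ecnt_le k n T G a).
have h2 : bexp p (ksets k n) (fun S => ecnt G S * (ecnt G S <= a)%R%:R) <= a * PG.
  rewrite -bexpZ; apply: bexp_le => // S _.
  by have [h|h] := leP (ecnt G S) a; rewrite ?mulr0 // !mulr1.
have h3 : b * (PG - PH) <= bexp p (ksets k n) (fun S => ecnt H S * (ecnt G S <= a)%R%:R).
  rewrite -mulN1r -bexpZ -bexpD -bexpZ; apply: bexp_le => // S _.
  have H0 : 0 <= ecnt H S :> R by exact: cnt_ge0.
  have [h|h] := leP (ecnt G S) a; have [h'|h'] := leP (ecnt H S) b;
    rewrite ?mulr0 ?mulr1 ?addr0 ?add0r ?subrr ?mulr0 //; first by rewrite mulr1 ltW.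
  by rewrite mulrN1 oppr_le0 ltW.
have r0 : 0 <= mean_copies H n p / mean_copies G n p by rewrite divr_ge0 // ltW.
have h4 := le_trans h3 (le_trans h1 (ler_wpM2l r0 h2)).
have e5 : mean_copies H n p / mean_copies G n p * (a * PG) = mean_copies H n p * ((1 - (1 + z) * eps) * PG).
  have aux (x y c q : R) : 0 < y -> x / y * (c * y * q) = x * (c * q).
    by move=> y0; field; rewrite gt_eqF.
  exact: aux.
have h5 : mean_copies H n p * ((1 - eps) * (PG - PH)) <= mean_copies H n p * ((1 - (1 + z) * eps) * PG).
  by rewrite -e5 mulrA [mean_copies H n p * _]mulrC.
rewrite ler_pM2l // in h5; have h6 : 0 <= eps * PH by rewrite mulr_ge0 // ltW.
clear - h5 h6; clearbody PG PH; lra.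
Qed.

Lemma copies_tail_ge k n T p (G H : kgraph k T) (z eps : R) :
  0 < p -> p <= 1 -> subgraph G H -> ncopies G H = 1%N ->
  0 < mean_copies G n p -> 0 < mean_copies H n p ->
  0 < z -> 0 < eps < 1 ->
  (if #|eset H| == #|eset G| then 1 else z * eps) *
    bexp p (ksets k n) (fun S => (ecnt G S <= (1 - (1 + z) * eps) * mean_copies G n p)%R%:R) <=
  bexp p (ksets k n) (fun S => (ecnt H S <= (1 - eps) * mean_copies H n p)%R%:R).
Proof.
move=> p_gt0 p_le1 hGH hcopy muG_gt0 muH_gt0; have hp : 0 <= p <= 1 by rewrite ltW.
move=> z0 heps; case: eqP => [eHG|_]; last exact: copies_tail_transfer.
rewrite mul1r; apply: bexp_le => // S _; rewrite ler_nat.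
have [h|//] := leP (ecnt G S) ((1 - (1 + z) * eps) * mean_copies G n p).
suff -> : ecnt H S <= (1 - eps) * mean_copies H n p by [].
rewrite (ecnt_same_size hGH hcopy S p_gt0 eHG).
have r0 : 0 <= mean_copies H n p / mean_copies G n p by rewrite divr_ge0 // ltW.
have -> : (1 - eps) * mean_copies H n p =
    mean_copies H n p / mean_copies G n p * ((1 - eps) * mean_copies G n p).
  have aux (x y c : R) : 0 < y -> c * x = x / y * (c * y).
    by move=> y0; field; rewrite gt_eqF.
  exact: aux.
apply: ler_wpM2l => //; apply: (le_trans h).
apply: ler_wpM2r; first exact: ltW.
case/andP: heps => e0 _; have : 0 <= z * eps by rewrite mulr_ge0 // ltW.
clear; lra.
Qed.

Lemma copies_tail_ge_zero k n T p (G H : kgraph k T) (a : R) :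
  0 < p -> p <= 1 -> ncopies G H = 1%N ->
  0 <= a ->
  bexp p (ksets k n) (fun S => (ecnt G S == 0 :> R)%:R) <=
  bexp p (ksets k n) (fun S => (ecnt H S <= a)%R%:R).
Proof.
move=> p_gt0 p_le1 hcopy; have hp : 0 <= p <= 1 by rewrite ltW.
move=> a0; apply: bexp_le => // S _; rewrite ler_nat; case: eqP => // h.
by rewrite (ecnt_eq0 hcopy h) a0.
Qed.

(** The width [(delta / 8) ^+ 2] keeps the square root of [1 - eps] below [delta / 8], so
    [phi (- eps)] is at least [(1 - delta / 8) ^+ 2]. Multiplied by [1 + delta] this still reaches
    [1 + delta / 4], which covers the Harris correction [1 + p ^+ #|eset G|]. *)
Lemma gnp_lower_tail_ge_zero k n T p (G H : kgraph k T) (delta eps : R) :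
  0 < p -> p <= 1 -> subgraph G H -> ncopies G H = 1%N -> (1 <= #|eset G|)%N ->
  0 < mean_copies G n p -> 0 < mean_copies H n p ->
  0 < delta <= 1 -> p <= delta / 4 ->
  1 - (delta / 8) ^+ 2 <= eps <= 1 -> 0 < eps ->
  expR (- ((1 + delta) * (phi (- eps) * mean_copies G n p))) <=
  gnp_prob p (fun K : kgraph k 'I_n => copies R H K <= (1 - eps) * mean_copies H n p).
Proof.
move=> p_gt0 p_le1 hGH hcopy eG1 muG_gt0 muH_gt0; have hp : 0 <= p <= 1 by rewrite ltW.
move=> /andP[d0 d1] pd /andP[e_ge e1] e0; rewrite gnp_prob_copies.
have a0 : 0 <= (1 - eps) * mean_copies H n p by rewrite mulr_ge0 ?subr_ge0 // ltW.
apply: le_trans (@copies_tail_ge_zero k n T p G H _ p_gt0 p_le1 hcopy a0).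
have q := exprn_le_base p_gt0 p_le1 eG1.
have q4 : p ^+ #|eset G| <= 1 / 4 by move: q; move: (p ^+ _) => x q; clear - q pd d1; lra.
have := @zero_lower R _ _ p _ _ _ _ hp (ksets_uniq k n)
  (fun F _ => @eset_ksets k n F) (@kcopies_card_eset k n T G) q4.
apply: le_trans; rewrite -mean_copiesE ler_expR lerN2 mulrA [leRHS]mulrC.
apply: ler_wpM2l; first exact: ltW.
have e01 : 0 < eps <= 1 by rewrite e0.
have := phi_ge_sqrt e01; set r := Num.sqrt _.
have r0 : 0 <= r by exact: sqrtr_ge0.
have rd : r <= delta / 8.
  have -> : delta / 8 = Num.sqrt ((delta / 8) ^+ 2).
    by rewrite sqrtr_sqr ger0_norm // divr_ge0 // ltW.
  by apply: ler_wsqrtr; clear - e_ge; lra.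
move=> hphi; apply: (@le_trans _ _ ((1 + delta) * (1 - r) ^+ 2)); last first.
  by apply: ler_wpM2l => //; clear - d0; lra.
apply: (@le_trans _ _ (1 + delta / 4)); first by move: q; move: (p ^+ _) => x q; clear - q pd; lra.
apply: (@le_trans _ _ ((1 + delta) * (1 - delta / 8) ^+ 2)).
  clear - d0 d1; nra.
apply: ler_wpM2l; first by clear - d0; lra.
by rewrite ler_sqr ?nnegrE; clear - rd d0 d1 r0; lra.
Qed.

(** Origin of the constants. The tilt is run with [eta / 2], which leaves room for
    [(1 + 2 * z) * eps] when [eps < 1 - eta]; [z] makes its relative error [40 * z / (eta / 2)]
    equal to [delta / 4], and [kap] meets the condition with 512 at [eta / 2]. The first summand of
    [W] gives the requirement with 32. The second bounds the cost of the prefactor, [z * eps / 2] or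
    just [1 / 2], by another [delta / 4] of the rate. *)
Lemma gnp_lower_tail_ge_tilt k n T p (G H : kgraph k T) (delta eta z kap W eps : R) :
  0 < p -> p <= 1 -> subgraph G H -> ncopies G H = 1%N -> (1 <= #|eset G|)%N ->
  0 < mean_copies G n p -> 0 < mean_copies H n p ->
  0 < delta <= 1 ->
  eta = (delta / 8) ^+ 2 -> z = delta * eta / 320 ->
  kap = z ^+ 2 * eta ^+ 2 / 2048 -> W = 32 / z ^+ 2 + (ln 2 - ln z + 1) * 16 / delta ->
  p <= kap -> overlap_bound n p G <= 1 + kap -> 0 < eps < 1 - eta ->
  W * (1 + (#|eset H| != #|eset G|)%:R * ln (1 / eps)) <= eps ^+ 2 * mean_copies G n p ->
  expR (- ((1 + delta) * (phi (- eps) * mean_copies G n p))) <=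
  gnp_prob p (fun K : kgraph k 'I_n => copies R H K <= (1 - eps) * mean_copies H n p).
Proof.
move=> p_gt0 p_le1 hGH hcopy eG1 muG_gt0 muH_gt0; have hp : 0 <= p <= 1 by rewrite ltW.
move=> /andP[d0 d1] etaE zE kapE WE pk hD /andP[e0 e1] hW; rewrite gnp_prob_copies.
have eta0 : 0 < eta by rewrite etaE exprn_gt0 // divr_gt0 // ltr0n.
have eta1 : eta <= 1 / 64 by rewrite etaE; clear - d0 d1; nra.
have z0 : 0 < z by rewrite zE; apply: divr_gt0; [exact: mulr_gt0 | rewrite ltr0n].
have z_eta : z <= eta / 320.
  rewrite zE; apply: ler_wpM2r; first by rewrite invr_ge0 ler0n.
  by apply: ler_piMl => //; exact: ltW.
have z1 : z <= 1 by clear - z_eta eta1; lra.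
have kap0 : 0 < kap.
  by rewrite kapE; apply: divr_gt0; [apply: mulr_gt0; exact: exprn_gt0 | rewrite ltr0n].
have eps01 : 0 < eps <= 1 by rewrite e0; clear - e1 eta0; lra.
have eps01' : 0 < eps < 1 by rewrite e0; clear - e1 eta0; lra.
have kap4 : kap <= 1 / 4.
  have : z ^+ 2 * eta ^+ 2 <= 1.
    by rewrite -exprMn exprn_ile1 //; [rewrite mulr_ge0 // ltW | clear - z0 z1 eta0 eta1; nra].
  by rewrite kapE; clear; lra.
have lz : ln z <= 0 by exact: ln_le0.
have l2 : 0 <= ln 2 :> R by apply: ln_ge0; rewrite ler1n.
have le0 : 0 <= ln (1 / eps).
  by rewrite ln_ge0 // ler_pdivlMr // mul1r; case/andP: eps01.
set c := (#|eset H| != #|eset G|)%:R in hW.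
have c01 : 0 <= c <= 1 by rewrite /c; case: (_ != _); rewrite /= ?lexx ?ler01.
set lam := 1 + c * ln (1 / eps) in hW.
have lam1 : 1 <= lam by rewrite /lam lerDl mulr_ge0 //; case/andP: c01.
have W1 : 32 / z ^+ 2 * lam + (ln 2 - ln z + 1) * 16 / delta * lam <= eps ^+ 2 * mean_copies G n p.
  by rewrite -mulrDl -WE.
have k16 : 0 <= (ln 2 - ln z + 1) * 16 / delta.
  by rewrite divr_ge0 // ?(ltW d0) // mulr_ge0 //; clear - l2 lz; lra.
have z2 : 0 < z ^+ 2 by rewrite exprn_gt0.
have h32 : 32 <= z ^+ 2 * (eps ^+ 2 * mean_copies G n p).
  rewrite mulrC -ler_pdivrMr //.
  have : 32 / z ^+ 2 <= 32 / z ^+ 2 * lam by rewrite ler_peMr // divr_ge0 // ltW.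
  have : 0 <= (ln 2 - ln z + 1) * 16 / delta * lam.
    by rewrite mulr_ge0 //; clear - lam1; lra.
  by move: W1; move: (mean_copies G n p) (32 / z ^+ 2) => m y; clear; lra.
have etah : 0 < eta / 2 <= 1 by clear - eta0 eta1; lra.
have z01 : 0 < z <= 1 by rewrite z0.
have tilt := tilted_lower_bound hp (ltW muG_gt0) etah z01 eps01 (ltW kap0) _ _ h32
  (fun s => @laplace_ecnt_ge _ n _ p G kap s p_gt0 p_le1 eG1 pk kap4)
  (fun s => @laplace_ecnt_le _ n _ p G kap s p_gt0 p_le1 kap0 hD).
apply: le_trans (copies_tail_ge p_gt0 p_le1 hGH hcopy muG_gt0 muH_gt0 z0 eps01').
set cc := (if _ then _ else _).
have cc0 : 0 < cc by rewrite /cc; case: ifP => // _; rewrite mulr_gt0.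
have lcc : ln z - c * ln (1 / eps) <= ln cc.
  rewrite /cc /c; case: (_ == _) => /=; first by rewrite ln1 mul0r subr0.
  by rewrite div1r lnV ?posrE // mul1r opprK lnM ?posrE.
apply: le_trans (ler_wpM2l (ltW cc0) (tilt _ _)); last 2 first.
- have : z * eps <= z by rewrite ler_piMr // ?(ltW z0) //; case/andP: eps01.
  by clear - e1 z_eta eta0; lra.
- by rewrite kapE; clear; lra.
have e80 : 40 * z / (eta / 2) = delta / 4.
  by rewrite zE; clear - eta0; field; rewrite gt_eqF.
rewrite e80.
have -> : cc * (expR (- (mean_copies G n p * (phi (- eps) * (1 + delta / 4)))) / 2) =
   expR (ln cc - ln 2 - mean_copies G n p * (phi (- eps) * (1 + delta / 4))).
  by rewrite expRD expRB !lnK ?posrE // -mulrA [expR _ / 2]mulrC.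
rewrite ler_expR.
have phie := phi_ge_sqr eps01.
have h1 : (ln 2 - ln z + 1) * 16 / delta * lam <= eps ^+ 2 * mean_copies G n p.
  have : 0 <= 32 / z ^+ 2 * lam by rewrite mulr_ge0 ?divr_ge0 ?(ltW z2) //; clear - lam1; lra.
  by move: W1; move: (mean_copies G n p) (32 / z ^+ 2 * lam) => m y; clear; lra.
have h2 : eps ^+ 2 * mean_copies G n p <= 4 * (phi (- eps) * mean_copies G n p).
  rewrite mulrA; apply: ler_wpM2r; first exact: ltW.
  by move: phie; move: (phi _) => f; clear; lra.
have h3 : (ln 2 - ln z + 1) * 16 * lam <= delta * (4 * (phi (- eps) * mean_copies G n p)).
  have := le_trans h1 h2; rewrite mulrAC ler_pdivrMr //; by rewrite [_ * delta]mulrC.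
have h4 : ln 2 - ln z + c * ln (1 / eps) <= (ln 2 - ln z + 1) * lam.
  have hc : 0 <= c * ln (1 / eps) by rewrite mulr_ge0 //; case/andP: c01.
  rewrite /lam; move: hc l2 lz; move: (c * _) (ln 2) (ln z) => x y w; clear; nra.
have h5 : 0 <= delta * (phi (- eps) * mean_copies G n p).
  apply: mulr_ge0; [exact: ltW | apply: mulr_ge0; last exact: ltW].
  by apply: le_trans phie; apply: divr_ge0; rewrite ?sqr_ge0 ?ler0n.
move: h3 h4 h5 lcc; move: (phi _) (mean_copies G n p) (ln 2) (ln z) (ln cc) (c * _) => f m a b d x.
move: (lam) => la; clear; lra.
Qed.

End FixedOrder.


(** * Asymptotics *)

Section Asymptotics.
Context {R : realType}.
Variables (k : nat) (T : finType).
Implicit Types (G H J : kgraph k T) (p : nat -> R).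

(** The term J = G is exactly EX_H / EX_G, and each of the finitely many other J contributes a
    vanishing fraction of it. For H this feeds Janson's inequality for X_H; for G inside itself it
    brings the dependency term of X_G close to 1. *)
Lemma overlap_bound_near G H p :
  subgraph G H -> ncopies G H = 1%N -> (1 <= #|eset G|)%N ->
  (forall n, 0 <= p n <= 1) ->
  (forall J : kgraph k T,
     subgraph J H -> J <> G -> (1 <= #|eset J|)%N ->
     (fun n : nat => mean_copies G n (p n)) =o_\oo
     (fun n : nat => mean_copies J n (p n))) ->
  forall kap : R, 0 < kap ->
  \forall n \near \oo, 0 < mean_copies G n (p n) ->
    overlap_bound n (p n) H <=
    (1 + kap) * (mean_copies H n (p n) / mean_copies G n (p n)).
Proof.
move=> hGH hcopy eG1 hp hJ kap kap0.
pose N : R := \sum_(J : kgraph k T) (ncopies J H)%:R.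
have N0 : 0 <= N by apply: sumr_ge0.
pose d := kap / (N + 1).
have d0 : 0 < d by rewrite divr_gt0 // ltr_wpDl.
have : \forall n \near \oo, forall J : kgraph k T,
    subgraph J H -> J != G -> (1 <= #|eset J|)%N ->
    `|mean_copies G n (p n)| <= d * `|mean_copies J n (p n)|.
  apply: filter_forall => J.
  have [JH|nJH] := boolP (subgraph J H); last by apply: nearW.
  have [->|JG] := eqVneq J G; first by apply: nearW.
  have [eJ|neJ] := boolP (1 <= #|eset J|)%N; last by apply: nearW.
  have /eqoP/(_ d d0) := hJ J JH (elimN eqP JG) eJ.
  by apply: filterS.
apply: filterS => n hn G0.
have muge J : 0 <= mean_copies J n (p n) := mean_copies_ge0 n (hp n) J.
rewrite /overlap_bound (bigD1 G) /=; last by rewrite hGH.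
rewrite hcopy mul1r mulrDl mul1r lerD2l.
set r := _ / _; have r0 : 0 <= r by rewrite divr_ge0.
apply: (@le_trans _ _ (\sum_(J : kgraph k T) (ncopies J H)%:R * (d * r))); last first.
  rewrite -mulr_suml mulrA ler_wpM2r // mulrCA ler_piMr ?(ltW kap0) //.
  by rewrite ler_pdivrMr ?ltr_wpDl // mul1r lerDl.
rewrite big_mkcond; apply: ler_sum => J _; case: ifP => [|_]; last first.
  by rewrite mulr_ge0 // mulr_ge0 // ltW.
move=> /andP[/andP[JH eJ] JG]; apply: ler_wpM2l => //.
have := hn J JH JG eJ; rewrite !ger0_norm // => hG.
have J0 : 0 < mean_copies J n (p n).
  by rewrite -(pmulr_rgt0 _ d0); apply: lt_le_trans hG.
have aux (a b c e : R) : a * (b / c) * e = b * (a * e / c) by ring.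
rewrite ler_pdivrMr // /r aux ler_peMr //.
by rewrite ler_pdivlMr // mul1r.
Qed.

Lemma mean_copies_gt0_near G H p :
  subgraph G H -> (1 <= #|eset G|)%N -> (forall n, 0 <= p n <= 1) ->
  (forall J : kgraph k T,
     subgraph J H -> J <> G -> (1 <= #|eset J|)%N ->
     (fun n : nat => mean_copies G n (p n)) =o_\oo
     (fun n : nat => mean_copies J n (p n))) ->
  \forall n \near \oo, 0 < mean_copies G n (p n) -> 0 < mean_copies H n (p n).
Proof.
move=> hGH eG1 hp hJ; have [->|HG] := eqVneq H G; first exact: nearW.
have HH : subgraph H H by apply/andP.
have eH : (1 <= #|eset H|)%N.
  by apply: leq_trans eG1 _; case/andP: hGH => _; exact: subset_leq_card.
have /eqoP/(_ 1 ltr01) := hJ H HH (elimN eqP HG) eH.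
apply: filterS => n; rewrite mul1r !ger0_norm ?mean_copies_ge0 // => h G0.
exact: lt_le_trans h.
Qed.

(** Settles the n with EX_G = 0, where both sides of the equivalence vanish. As X_H is integer
    valued, the indicator of X_H <= 0 is at least 1 - X_H, which has mean 1. *)
Lemma copies_tail_mean0 H n (p eps : R) : 0 <= p <= 1 -> mean_copies H n p = 0 ->
  gnp_prob p (fun K : kgraph k 'I_n => copies R H K <= (1 - eps) * mean_copies H n p) = 1.
Proof.
move=> hp H0; rewrite gnp_prob_copies H0 mulr0; apply/eqP; rewrite eq_le; apply/andP; split.
  rewrite -[leRHS](bexp_cst p (ksets k n)); apply: bexp_le => // S _.
  by rewrite lern1 leq_b1.
have hE : bexp p (ksets k n) (ecnt H) = 0.
  rewrite -H0 mean_copiesE; apply: bexp_cnt (ksets_uniq k n) _ _ => F.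
    by move=> _; exact: eset_ksets.
  exact: kcopies_card_eset.
have h1 : bexp p (ksets k n) (fun S => 1 + -1 * ecnt H S) = 1 :> R.
  by rewrite bexpD bexp_cst bexpZ hE mulr0 addr0.
rewrite -[leLHS]h1; apply: bexp_le => // S _; rewrite mulN1r /ecnt /cnt -natr_sum.
move: (\sum_(i in _) _)%N => m; rewrite lern0; case: m => [|m] /=; first by rewrite subr0.
by rewrite subr_le0 ler1n.
Qed.

End Asymptotics.

Theorem theorem4 (R : realType) (k : nat) (T : finType) (G H : kgraph k T)
  (p eps : nat -> R)
  (hk : (2 <= k)%N)
  (hGH : subgraph G H)
  (heG : (1 <= #|eset G|)%N)
  (hcopy : ncopies G H = 1%N)
  (hp01 : forall n : nat, 0 <= p n <= 1)
  (hp0 : p @ \oo --> (0 : R))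
  (hJ : forall J : kgraph k T,
     subgraph J H -> J <> G -> (1 <= #|eset J|)%N ->
     (fun n : nat => mean_copies G n (p n)) =o_\oo
     (fun n : nat => mean_copies J n (p n)))
  (heps : forall n : nat, 0 < eps n <= 1)
  (homega : exists omega : nat -> R,
     omega @ \oo --> +oo /\
     forall n : nat,
       eps n ^+ 2 * mean_copies G n (p n) >=
       (eps n < 1)%R%:R *
       (omega n *
        (1 + ((G != H) && (2 <= #|eset G|)%N)%:R * ln (1 / eps n)))) :
  (fun n : nat =>
     ln (gnp_prob (p n) (fun K : kgraph k 'I_n =>
           copies R H K <= (1 - eps n) * mean_copies H n (p n)))) ~_\oo
  (fun n : nat => - phi (- eps n) * mean_copies G n (p n)).
Proof.
apply/eqaddoP => delta0 delta00.
pose delta := Num.min delta0 1.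
have d0 : 0 < delta by rewrite lt_min delta00 ltr01.
have d1 : delta <= 1 by rewrite ge_min lexx orbT.
have dd0 : delta <= delta0 by rewrite ge_min lexx.
pose eta := (delta / 8) ^+ 2; pose z := delta * eta / 320.
pose kap := z ^+ 2 * eta ^+ 2 / 2048.
pose W := 32 / z ^+ 2 + (ln 2 - ln z + 1) * 16 / delta.
have eta0 : 0 < eta by rewrite /eta exprn_gt0 // divr_gt0 // ltr0n.
have eta1 : eta <= 1 by rewrite /eta; clear - d0 d1; nra.
have z0 : 0 < z by rewrite /z; apply: divr_gt0; [exact: mulr_gt0 | rewrite ltr0n].
have z_le : z <= delta / 4.
  rewrite /z; have : delta * eta <= delta by rewrite ler_piMr // ltW.
  by move: (delta * eta) => x; clear - d0; lra.
have kap0 : 0 < kap.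
  by rewrite /kap; apply: divr_gt0; [apply: mulr_gt0; exact: exprn_gt0 | rewrite ltr0n].
have kap_le : kap <= delta / 4.
  apply: (le_trans _ z_le); rewrite /kap.
  have h1 : z ^+ 2 * eta ^+ 2 <= z ^+ 2 by rewrite ler_piMr ?sqr_ge0 // exprn_ile1 // ltW.
  have h2 : z ^+ 2 <= z.
    rewrite expr2 ler_piMr // ?(ltW z0) //; apply: (le_trans z_le); clear - d1; lra.
  by move: (le_trans h1 h2); move: (z ^+ 2 * _) => x; clear - z0; lra.
have dpos : 0 < delta <= 1 by rewrite d0.
(* The hypotheses on H pass to G, a subgraph of G being one of H; this gives the overlap bound for
   X_G itself. *)
have GG : subgraph G G by apply/andP.
have cGG : ncopies G G = 1%N.
  apply/eqP/cards1P; exists G; apply/finset.setP => F; rewrite !inE.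
  apply/andP/eqP => [[FG iF]|->]; last by rewrite GG isomorphic_refl.
  apply: (unique_copy hGH hcopy) => //.
  case/andP: FG => f1 f2; case/andP: hGH => g1 g2.
  by apply/andP; split; [exact: fintype.subset_trans g1 | exact: fintype.subset_trans g2].
have hJG (J : kgraph k T) : subgraph J G -> J <> G -> (1 <= #|eset J|)%N ->
     (fun n : nat => mean_copies G n (p n)) =o_\oo
     (fun n : nat => mean_copies J n (p n)).
  move=> /andP[f1 f2]; apply: hJ; case/andP: hGH => g1 g2.
  by apply/andP; split; [exact: fintype.subset_trans g1 | exact: fintype.subset_trans g2].
case: homega => omega [omega_oo homega].
have n1 : \forall n \near \oo, p n < kap by apply: (cvgr_lt _ hp0).
have n2 := overlap_bound_near GG cGG heG hp01 hJG kap0.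
have n3 := overlap_bound_near hGH hcopy heG hp01 hJ kap0.
have n4 := mean_copies_gt0_near hGH heG hp01 hJ.
have n5 : \forall n \near \oo, W <= omega n by move/cvgryPge: omega_oo; exact.
near=> n.
have m1 : p n < kap by near: n; exact: n1.
have m2 : 0 < mean_copies G n (p n) -> overlap_bound n (p n) G <=
  (1 + kap) * (mean_copies G n (p n) / mean_copies G n (p n)) by near: n; exact: n2.
have m3 : 0 < mean_copies G n (p n) -> overlap_bound n (p n) H <=
  (1 + kap) * (mean_copies H n (p n) / mean_copies G n (p n)) by near: n; exact: n3.
have m4 : 0 < mean_copies G n (p n) -> 0 < mean_copies H n (p n) by near: n; exact: n4.
have m5 : W <= omega n by near: n; exact: n5.
have e01 := heps n; have {}homega := homega n.
rewrite !fctE.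
have [G0|G0] := eqVneq (mean_copies G n (p n)) 0.
  rewrite (copies_tail_mean0 _ (hp01 n) (mean_copies_eq0 hGH hcopy G0)) G0.
  by rewrite ln1 mulr0 subrr normr0 mulr0.
have {G0}G0 : 0 < mean_copies G n (p n).
  by rewrite lt_neqAle eq_sym G0 mean_copies_ge0.
have {m2}m2 : overlap_bound n (p n) G <= 1 + kap.
  by apply: (le_trans (m2 G0)); rewrite divff ?mulr1 // gt_eqF.
have {}m3 := m3 G0; have {}m4 := m4 G0.
have p0 : 0 < p n.
  rewrite lt_neqAle; have /andP[-> _] := hp01 n; rewrite andbT.
  apply: contraTneq G0 => <-; rewrite mean_copiesE expr0n gtn_eqF //.
  by rewrite mulr0 ltxx.
have p1 : p n <= 1 by case/andP: (hp01 n).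
have phi0 : 0 <= phi (- eps n).
  by apply: le_trans (phi_ge_sqr e01); rewrite divr_ge0 ?sqr_ge0.
have lower : expR (- ((1 + delta) * (phi (- eps n) * mean_copies G n (p n)))) <=
  gnp_prob (p n) (fun K : kgraph k 'I_n => copies R H K <= (1 - eps n) * mean_copies H n (p n)).
  (* The first case contains [eps n = 1], where [homega] gives no lower bound on EX_G. *)
  have [e_ge|e_lt] := leP (1 - eta) (eps n).
    apply: (gnp_lower_tail_ge_zero p0 p1 hGH hcopy heG G0 m4 dpos).
    - by apply: le_trans kap_le; exact: ltW.
    - by rewrite e_ge; case/andP: e01.
    - by case/andP: e01.
  apply: (gnp_lower_tail_ge_tilt p0 p1 hGH hcopy heG G0 m4 dpos
    (erefl eta) (erefl z) (erefl kap) (erefl W) (ltW m1) m2).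
    by rewrite e_lt; case/andP: e01 => ->.
  have e_lt1 : eps n < 1 by apply: (lt_trans e_lt); rewrite gtrBl.
  apply: le_trans homega; rewrite e_lt1 [true%:R * _]mul1r.
  have l0 : 0 <= ln (1 / eps n).
    by case/andP: e01 => e0 e1; rewrite ln_ge0 // ler_pdivlMr // mul1r.
  have W0 : 0 <= W.
    have hz : ln z <= 0.
      by apply: ln_le0; apply: (le_trans z_le); clear - d1; lra.
    have hl2 : 0 <= ln 2 :> R by apply: ln_ge0; rewrite ler1n.
    rewrite /W; apply: addr_ge0; apply: divr_ge0; rewrite ?sqr_ge0 ?ler0n ?(ltW d0) //.
    by apply: mulr_ge0 => //; clear - hz hl2; lra.
  (* A logarithm is lost only if the edge numbers differ; then G and H differ, and G has at least
     two edges because a one-edge G would force a one-edge H. *)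
  have bb : ((#|eset H| != #|eset G|) <= (G != H) && (2 <= #|eset G|))%N.
    case: eqP => //= neq; rewrite lt0b; apply/andP; split.
      by apply: contra_not_neq neq => ->.
    rewrite ltn_neqAle heG andbT eq_sym; apply: contra_not_neq neq => e1.
    by rewrite e1 (single_edge_unique hGH hcopy (ltnW hk) e1).
  apply: ler_pM => //; first by apply: addr_ge0 => //; apply: mulr_ge0.
  by rewrite lerD2l ler_wpM2r // ler_nat.
set P := gnp_prob _ _ in lower *.
have P0 : 0 < P by apply: lt_le_trans lower; exact: expR_gt0.
have upper : P <= expR (- (phi (- eps n) * mean_copies G n (p n) / (1 + kap))).
  (* This choice of [D] turns Janson's EX_H / D into EX_G / (1 + kap). *)
  have D0 : 0 < (1 + kap) * (mean_copies H n (p n) / mean_copies G n (p n)).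
    by rewrite mulr_gt0 ?divr_gt0 // addr_gt0.
  apply: le_trans (gnp_lower_tail_le p0 p1 D0 m3 e01) _.
  rewrite ler_expR lerN2 le_eqVlt; apply/orP; left; apply/eqP.
  have aux (x y f c : R) : 0 < x -> 0 < y -> 0 < c -> f * y / c = x / (c * (x / y)) * f.
    by move=> x0 y0 c0; field; rewrite !gt_eqF.
  by apply: aux => //; rewrite addr_gt0.
have {}lower : - ((1 + delta) * (phi (- eps n) * mean_copies G n (p n))) <= ln P.
  by rewrite -[leLHS]expRK ler_ln ?posrE ?expR_gt0.
have {}upper : ln P <= - (phi (- eps n) * mean_copies G n (p n) / (1 + kap)).
  by rewrite -[leRHS]expRK ler_ln ?posrE ?expR_gt0.
rewrite mulNr normrN opprK.
have : 0 <= phi (- eps n) * mean_copies G n (p n) by rewrite mulr_ge0 // ltW.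
move: lower upper; move: (ln P) (phi _ * _) => a m lower upper m0.
rewrite (ger0_norm m0).
have hm : (1 - kap) * m <= m / (1 + kap).
  rewrite ler_pdivlMr ?addr_gt0 // mulrAC -[leRHS]mul1r; apply: ler_wpM2r => //.
  by clear; nra.
have h1 : kap * m <= delta * m.
  by apply: ler_wpM2r => //; clear - kap_le d0; lra.
have h2 : delta * m <= delta0 * m by apply: ler_wpM2r.
by rewrite ler_norml; apply/andP; split; clear - lower upper hm h1 h2; lra.
Unshelve. all: by end_near.
Qed.
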